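(* Let $\mathbf L$ be a complex $4$-dimensional nilpotent left-symmetric algebra. Then either $\mathbf L$ is a Novikov algebra, or $\mathbf L$ is isomorphic to one algebra from the following list. Each algebra in the list has underlying vector space with basis $e_1,e_2,e_3,e_4$ over $\mathbb C$, and all products of basis elements that are not listed are zero. - $\mathbf L^4_{01}$: $e_1e_1=e_2$, $e_1e_2=e_4$, $e_2e_3=e_4$, $e_3e_1=e_4$. - $\mathbf L^4_{02}$: $e_1e_1=e_2$, $e_2e_3=e_4$, $e_3e_1=e_4$. - $\mathbf L^4_{03}$: $e_1e_1=e_2$, $e_1e_2=e_4$, $e_2e_3=e_4$. - $\mathbf L^4_{04}$: $e_1e_1=e_2$, $e_2e_3=e_4$. - $\mathbf L^4_{05}$: $e_1e_1=e_3$, $e_2e_2=e_3$, $e_3e_1=e_4$. - $\mathbf L^4_{06}$: $e_1e_1=e_3$, $e_1e_2=e_4$, $e_2e_2=e_3$, $e_3e_1=e_4$. - $\mathbf L^4_{07}$: $e_1e_1=e_3$, $e_2e_2=e_3$, $e_3e_1=e_4$, $e_3e_2=ie_4$. - $\mathbf L^4_{08}$: $e_1e_1=e_3$, $e_1e_2=e_4$, $e_2e_2=e_3$, $e_3e_1=e_4$, $e_3e_2=ie_4$. - $\mathbf L^4_{09}$: $e_1e_2=e_3$, $e_1e_3=-2e_4$, $e_2e_1=-e_3$, $e_3e_1=e_4$. - $\mathbf L^4_{10}$: $e_1e_2=e_3$, $e_1e_3=-2e_4$, $e_2e_1=-e_3$, $e_2e_2=e_4$, $e_3e_1=e_4$.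 - $\mathbf L^4_{11}(\lambda)$, $\lambda\neq0$: $e_1e_1=\lambda e_3$, $e_2e_1=e_3$, $e_2e_2=e_3$, $e_2e_3=e_4$, $e_3e_1=\lambda e_4$. - $\mathbf L^4_{12}(\lambda)$, $\lambda\neq0$: $e_1e_1=\lambda e_3$, $e_1e_2=e_4$, $e_2e_1=e_3$, $e_2e_2=e_3$, $e_2e_3=e_4$, $e_3e_1=\lambda e_4$. - $\mathbf L^4_{13}(\lambda)$, $\lambda\neq0$: $e_1e_1=\lambda e_3$, $e_2e_1=e_3$, $e_2e_2=e_3$, $e_1e_3=2\lambda e_4$, $e_2e_3=(1-\sqrt{1-4\lambda})e_4$, $e_3e_1=-\lambda(1+\sqrt{1-4\lambda})e_4$, $e_3e_2=-2\lambda e_4$. - $\mathbf L^4_{14}(\lambda)$, $\lambda\neq0$: $e_1e_1=\lambda e_3$, $e_2e_1=e_3$, $e_2e_2=e_3+e_4$, $e_1e_3=2\lambda e_4$, $e_2e_3=(1-\sqrt{1-4\lambda})e_4$, $e_3e_1=-\lambda(1+\sqrt{1-4\lambda})e_4$, $e_3e_2=-2\lambda e_4$. - $\mathbf L^4_{15}(\lambda)$, $\lambda\neq0$: $e_1e_1=\lambda e_3$, $e_2e_1=e_3$, $e_2e_2=e_3$, $e_1e_3=2\lambda e_4$, $e_2e_3=(1+\sqrt{1-4\lambda})e_4$, $e_3e_1=-\lambda(1-\sqrt{1-4\lambda})e_4$, $e_3e_2=-2\lambda e_4$. - $\mathbf L^4_{16}(\lambda)$, $\lambda\neq0$: $e_1e_1=\lambda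 e_3$, $e_2e_1=e_3$, $e_2e_2=e_3+e_4$, $e_1e_3=2\lambda e_4$, $e_2e_3=(1+\sqrt{1-4\lambda})e_4$, $e_3e_1=-\lambda(1-\sqrt{1-4\lambda})e_4$, $e_3e_2=-2\lambda e_4$. - $\mathbf L^4_{17}(\alpha)$: $e_1e_1=e_2$, $e_1e_3=\alpha e_4$, $e_2e_1=e_3$, $e_2e_2=e_4$, $e_3e_1=(1-\alpha)e_4$. - $\mathbf L^4_{18}$: $e_1e_1=e_2$, $e_1e_2=e_4$, $e_1e_3=-e_4$, $e_2e_1=e_3$, $e_2e_2=e_4$, $e_3e_1=2e_4$. - $\mathbf L^4_{19}$: $e_1e_1=e_2$, $e_2e_1=e_3$, $e_2e_3=e_4$. - $\mathbf L^4_{20}$: $e_1e_1=e_2$, $e_1e_3=e_4$, $e_2e_1=e_3$, $e_2e_3=e_4$, $e_3e_1=-e_4$. - $\mathbf L^4_{21}(\alpha)$: $e_1e_1=e_2$, $e_1e_2=e_4$, $e_1e_3=\alpha e_4$, $e_2e_1=e_3$, $e_2e_3=e_4$, $e_3e_1=-\alpha e_4$. - $\mathbf L^4_{22}(\alpha)$: $e_1e_1=e_2$, $e_1e_2=e_3$, $e_1e_3=(2\alpha+1)e_4$, $e_2e_1=e_4$, $e_2e_2=e_4$, $e_3e_1=-e_4$. - $\mathbf L^4_{23}(\lambda,\alpha)$: $e_1e_1=e_2$, $e_1e_2=e_3$, $e_1e_3=\big((2-\lambda)\alpha+1\big)e_4$, $e_2e_1=\lambda e_3$, $e_2e_2=(\lambda\alpha+1)e_4$,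 $e_3e_1=(\lambda\alpha-1)e_4$. - $\mathbf L^4_{24}(\lambda)$, $\lambda\notin\{0,1\}$: $e_1e_1=e_2$, $e_1e_2=e_3$, $e_1e_3=2(3-\lambda)e_4$, $e_2e_1=\lambda e_3+e_4$, $e_2e_2=2\lambda(\lambda+1)e_4$, $e_3e_1=4\lambda e_4$. Here $\lambda,\alpha$ denote complex parameters, subject only to the restrictions indicated.
   Context: All algebras are over $\mathbb C$; an algebra is a vector space with a bilinear product, not assumed associative, commutative or unital. A left-symmetric algebra is an algebra satisfying $(xy)z-x(yz)=(yx)z-y(xz)$ for all $x,y,z$. A Novikov algebra is a left-symmetric algebra that also satisfies $(xy)z=(xz)y$ for all $x,y,z$. An algebra $A$ is nilpotent if $A^k=0$ for some $k$, where $A^1=A$ and $A^{k}=\sum_{j=1}^{k-1}A^{j}A^{k-j}$. The symbol $i$ in $ie_4$ is the imaginary unit, and $\sqrt{1-4\lambda}$ denotes a fixed choice of square root of $1-4\lambda$ for each $\lambda$ (the same choice in all the algebras where it appears). *)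

(* Defs.v *)
From HB Require Import structures.
From mathcomp Require Import all_boot all_order all_algebra.
From mathcomp Require Import reals complex.

Set Implicit Arguments.
Unset Strict Implicit.
Unset Printing Implicit Defensive.

Import Order.TTheory GRing.Theory Num.Theory.

Local Open Scope ring_scope.

(* Finite-dimensional algebras with an arbitrary bilinear product (MathComp's
   algebra structures all require associativity and a unit). *)
Record algebra (K : fieldType) := MkAlgebra {
  carrier :> vectType K;
  amul : {bilinear carrier -> carrier -> carrier} }.

Declare Scope alg_scope.
Delimit Scope alg_scope with alg.
Notation "x * y" := (amul _ x y) : alg_scope.

Section Algebras.
Variable K : fieldType.
Implicit Types A B : algebra K.

Definition left_symmetric A : Prop := forall x y z : A,
  (((x * y) * z)%alg - (x * (y * z))%alg
   = ((y * x) * z)%alg - (y * (x * z))%alg).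

Definition novikov A : Prop :=
  left_symmetric A /\
  forall x y z : A, ((x * y) * z)%alg = ((x * z) * y)%alg.

Definition isomorphic A B : Prop :=
  exists2 f : 'Hom(A, B), bijective f &
    forall x y : A, f (x * y)%alg = (f x * f y)%alg.

(* The span of all products u * w with u in U and w in W, see mulvP. *)
Definition mulv A (U W : {vspace A}) : {vspace A} :=
  <<[seq (u * w)%alg | u <- vbasis U, w <- vbasis W]>>%VS.

(* [:: A^1; ...; A^n] *)
Fixpoint powers A (n : nat) : seq {vspace A} :=
  if n is m.+1 then
    let s := powers A m in
    rcons s (if m is 0 then fullv
             else (\sum_(j < m) mulv (nth 0 s j) (nth 0 s (m.-1 - j)))%VS)
  else [::].

(* A^k for k >= 1, see power1 and powerE. *)
Definition power A (k : nat) : {vspace A} := nth 0%VS (powers A k) k.-1.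

Definition nilpotent A : Prop := exists2 k, (0 < k)%N & power A k = 0%VS.

Lemma mulvP A (U W T : {vspace A}) :
  reflect (forall u w, u \in U -> w \in W -> (u * w)%alg \in T)
          (mulv U W <= T)%VS.
Proof.
apply: (iffP idP) => [sT u w Uu Ww | sT].
  apply: (subvP sT); rewrite (coord_vbasis Uu) (coord_vbasis Ww).
  rewrite linear_sumlz; apply: memv_suml => i _.
  rewrite linear_sumr; apply: memv_suml => j _.
  rewrite linearZl_LR linearZr_LR /= !memvZ // memv_span //.
  by apply: allpairs_f; rewrite mem_nth // size_tuple.
by apply/span_subvP => _ /allpairsP[[u w] /= [Uu Ww ->]]; apply: sT;
  apply: vbasis_mem.
Qed.

Lemma size_powers A n : size (powers A n) = n.
Proof. by elim: n => //= n IHn; rewrite size_rcons IHn. Qed.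

Lemma nth_powers A n j : (j < n)%N -> nth 0%VS (powers A n) j = power A j.+1.
Proof.
elim: n => // n IHn; rewrite ltnS leq_eqVlt => /predU1P[-> // | lt_jn].
by rewrite [LHS]/= nth_rcons size_powers lt_jn IHn.
Qed.

Lemma power1 A : power A 1 = fullv.
Proof. by []. Qed.

Lemma powerE A k : (1 < k)%N ->
  power A k = (\sum_(1 <= j < k) mulv (power A j) (power A (k - j)))%VS.
Proof.
case: k => [|[|m]] // _; rewrite big_add1 big_mkord.
rewrite {1}/power [powers A _]/= -/(powers A m.+1).
rewrite nth_rcons size_powers ltnn eqxx; apply: eq_bigr => -[j lt_jm] _ /=.
rewrite -/(powers A m.+1) !nth_powers //; last by rewrite ltnS leq_subr.
by rewrite subSS -subSn.
Qed.

(* e 1, e 2, e 3, e 4 (indices start at 1) is the standard basis. *)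
Definition e (i : nat) : 'rV[K]_4 := delta_mx 0 (inord i.-1).

Definition coef (x : 'rV[K]_4) (i : nat) : K := x 0 (inord i.-1).

(* A table lists triples (i, j, v), written i ** j ~> v and meaning
   e i * e j = v; products of basis elements that are not listed are zero, see
   table_mulE. *)
Definition table := seq (nat * nat * 'rV[K]_4).

Definition table_mul (t : table) (x y : 'rV[K]_4) : 'rV[K]_4 :=
  \sum_(p <- t) (coef x p.1.1 * coef y p.1.2) *: p.2.

Lemma coef_e i j : (0 < i <= 4)%N -> (0 < j <= 4)%N ->
  coef (e i) j = (i == j)%:R.
Proof.
case: i => // i; case: j => // j /= lt_i4 lt_j4.
by rewrite /coef mxE eqxx /= eq_sym -val_eqE /= !inordK.
Qed.

Lemma table_mulE (t : table) i j : (0 < i <= 4)%N -> (0 < j <= 4)%N ->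
  all (fun p => (0 < p.1.1 <= 4) && (0 < p.1.2 <= 4))%N t ->
  table_mul t (e i) (e j) = \sum_(p <- t | p.1 == (i, j)) p.2.
Proof.
move=> i14 j14 /allP t14; rewrite /table_mul [RHS]big_mkcond /=.
apply: eq_big_seq => -[[a b] v] /t14/andP[/= a14 b14].
rewrite !coef_e // xpair_eqE /= [a == i]eq_sym [b == j]eq_sym.
by case: (i == a); case: (j == b);
  rewrite /= ?mulr1 ?mulr0 ?mul0r ?scale1r ?scale0r.
Qed.

Fact table_mul_bilinear (t : table) :
  bilinear_for *:%R *:%R (table_mul t).
Proof.
split=> [y a x x' | x a y y'] /=; rewrite /applyr /table_mul scaler_sumr -big_split;
  apply: eq_bigr => p _ /=; rewrite /coef !mxE scalerA -scalerDl; congr (_ *: _).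
  by rewrite mulrDl mulrA.
by rewrite mulrDr mulrCA.
Qed.

HB.instance Definition _ (t : table) :=
  bilinear_isBilinear.Build K 'rV[K]_4 'rV[K]_4 'rV[K]_4 *:%R *:%R
    (table_mul t) (table_mul_bilinear t).

Definition table_algebra (t : table) : algebra K :=
  @MkAlgebra K 'rV[K]_4 (table_mul t).

End Algebras.

Arguments e {K} i%_N.

Notation "i ** j ~> v" := (i%N, j%N, v%R)
  (at level 70, j at level 39, v at level 69, no associativity) : alg_scope.

Section Classification.
Variables (R : realType) (sqrt : R[i] -> R[i]).
Implicit Types lambda alpha : R[i].

(* 'i%C is the imaginary unit; sqrt is a choice of square roots. *)
Inductive listed : table R[i] -> Prop :=
| L4_01 : listed [:: 1 ** 1 ~> e 2; 1 ** 2 ~> e 4; 2 ** 3 ~> e 4;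
                     3 ** 1 ~> e 4]%alg
| L4_02 : listed [:: 1 ** 1 ~> e 2; 2 ** 3 ~> e 4; 3 ** 1 ~> e 4]%alg
| L4_03 : listed [:: 1 ** 1 ~> e 2; 1 ** 2 ~> e 4; 2 ** 3 ~> e 4]%alg
| L4_04 : listed [:: 1 ** 1 ~> e 2; 2 ** 3 ~> e 4]%alg
| L4_05 : listed [:: 1 ** 1 ~> e 3; 2 ** 2 ~> e 3; 3 ** 1 ~> e 4]%alg
| L4_06 : listed [:: 1 ** 1 ~> e 3; 1 ** 2 ~> e 4; 2 ** 2 ~> e 3;
                     3 ** 1 ~> e 4]%alg
| L4_07 : listed [:: 1 ** 1 ~> e 3; 2 ** 2 ~> e 3; 3 ** 1 ~> e 4;
                     3 ** 2 ~> 'i%C *: e 4]%alg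
| L4_08 : listed [:: 1 ** 1 ~> e 3; 1 ** 2 ~> e 4; 2 ** 2 ~> e 3;
                     3 ** 1 ~> e 4; 3 ** 2 ~> 'i%C *: e 4]%alg
| L4_09 : listed [:: 1 ** 2 ~> e 3; 1 ** 3 ~> (- 2) *: e 4; 2 ** 1 ~> - e 3;
                     3 ** 1 ~> e 4]%alg
| L4_10 : listed [:: 1 ** 2 ~> e 3; 1 ** 3 ~> (- 2) *: e 4; 2 ** 1 ~> - e 3;
                     2 ** 2 ~> e 4; 3 ** 1 ~> e 4]%alg
| L4_11 lambda of lambda != 0 :
    listed [:: 1 ** 1 ~> lambda *: e 3; 2 ** 1 ~> e 3; 2 ** 2 ~> e 3;
               2 ** 3 ~> e 4; 3 ** 1 ~> lambda *: e 4]%alg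
| L4_12 lambda of lambda != 0 :
    listed [:: 1 ** 1 ~> lambda *: e 3; 1 ** 2 ~> e 4; 2 ** 1 ~> e 3;
               2 ** 2 ~> e 3; 2 ** 3 ~> e 4; 3 ** 1 ~> lambda *: e 4]%alg
| L4_13 lambda of lambda != 0 :
    listed [:: 1 ** 1 ~> lambda *: e 3; 2 ** 1 ~> e 3; 2 ** 2 ~> e 3;
               1 ** 3 ~> (2 * lambda) *: e 4;
               2 ** 3 ~> (1 - sqrt (1 - 4 * lambda)) *: e 4;
               3 ** 1 ~> (- lambda * (1 + sqrt (1 - 4 * lambda))) *: e 4;
               3 ** 2 ~> (- 2 * lambda) *: e 4]%alg
| L4_14 lambda of lambda != 0 :
    listed [:: 1 ** 1 ~> lambda *: e 3; 2 ** 1 ~> e 3; 2 ** 2 ~> e 3 + e 4;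
               1 ** 3 ~> (2 * lambda) *: e 4;
               2 ** 3 ~> (1 - sqrt (1 - 4 * lambda)) *: e 4;
               3 ** 1 ~> (- lambda * (1 + sqrt (1 - 4 * lambda))) *: e 4;
               3 ** 2 ~> (- 2 * lambda) *: e 4]%alg
| L4_15 lambda of lambda != 0 :
    listed [:: 1 ** 1 ~> lambda *: e 3; 2 ** 1 ~> e 3; 2 ** 2 ~> e 3;
               1 ** 3 ~> (2 * lambda) *: e 4;
               2 ** 3 ~> (1 + sqrt (1 - 4 * lambda)) *: e 4;
               3 ** 1 ~> (- lambda * (1 - sqrt (1 - 4 * lambda))) *: e 4;
               3 ** 2 ~> (- 2 * lambda) *: e 4]%alg
| L4_16 lambda of lambda != 0 :
    listed [:: 1 ** 1 ~> lambda *: e 3; 2 ** 1 ~> e 3; 2 ** 2 ~> e 3 + e 4;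
               1 ** 3 ~> (2 * lambda) *: e 4;
               2 ** 3 ~> (1 + sqrt (1 - 4 * lambda)) *: e 4;
               3 ** 1 ~> (- lambda * (1 - sqrt (1 - 4 * lambda))) *: e 4;
               3 ** 2 ~> (- 2 * lambda) *: e 4]%alg
| L4_17 alpha :
    listed [:: 1 ** 1 ~> e 2; 1 ** 3 ~> alpha *: e 4; 2 ** 1 ~> e 3;
               2 ** 2 ~> e 4; 3 ** 1 ~> (1 - alpha) *: e 4]%alg
| L4_18 : listed [:: 1 ** 1 ~> e 2; 1 ** 2 ~> e 4; 1 ** 3 ~> - e 4;
                     2 ** 1 ~> e 3; 2 ** 2 ~> e 4; 3 ** 1 ~> 2 *: e 4]%alg
| L4_19 : listed [:: 1 ** 1 ~> e 2; 2 ** 1 ~> e 3; 2 ** 3 ~> e 4]%alg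
| L4_20 : listed [:: 1 ** 1 ~> e 2; 1 ** 3 ~> e 4; 2 ** 1 ~> e 3;
                     2 ** 3 ~> e 4; 3 ** 1 ~> - e 4]%alg
| L4_21 alpha :
    listed [:: 1 ** 1 ~> e 2; 1 ** 2 ~> e 4; 1 ** 3 ~> alpha *: e 4;
               2 ** 1 ~> e 3; 2 ** 3 ~> e 4; 3 ** 1 ~> (- alpha) *: e 4]%alg
| L4_22 alpha :
    listed [:: 1 ** 1 ~> e 2; 1 ** 2 ~> e 3;
               1 ** 3 ~> (2 * alpha + 1) *: e 4; 2 ** 1 ~> e 4;
               2 ** 2 ~> e 4; 3 ** 1 ~> - e 4]%alg
| L4_23 lambda alpha :
    listed [:: 1 ** 1 ~> e 2; 1 ** 2 ~> e 3;
               1 ** 3 ~> ((2 - lambda) * alpha + 1) *: e 4;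
               2 ** 1 ~> lambda *: e 3;
               2 ** 2 ~> (lambda * alpha + 1) *: e 4;
               3 ** 1 ~> (lambda * alpha - 1) *: e 4]%alg
| L4_24 lambda of lambda != 0 & lambda != 1 :
    listed [:: 1 ** 1 ~> e 2; 1 ** 2 ~> e 3;
               1 ** 3 ~> (2 * (3 - lambda)) *: e 4;
               2 ** 1 ~> lambda *: e 3 + e 4;
               2 ** 2 ~> (2 * lambda * (lambda + 1)) *: e 4;
               3 ** 1 ~> (4 * lambda) *: e 4]%alg.

End Classification.

(* Main.v *)
From HB Require Import structures.
Require Import Defs.
From mathcomp Require Import all_boot all_order all_algebra.
From mathcomp Require Import reals complex ring.

Set Implicit Arguments.
Unset Strict Implicit.
Unset Printing Implicit Defensive.

Import GRing.Theory Num.Theory.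
Local Open Scope ring_scope.

(** The classification is a reduction to normal forms for two families of
    structure constants.

    Let D0 = L and let D(k+1) = D(k) L + L D(k). Nilpotency makes this series
    strictly decreasing down to 0 ([descend_dim]), and left symmetry gives
    D(k) D1 <= D(k+2) ([series_mul]). If dim D1 <= 1 then D2 = 0, all triple
    products vanish and L is Novikov. Otherwise L has 4 - dim D1 generators, one
    or two, and the inclusions above leave few products that can be nonzero:

    - with two generators e1, e2 and D1 spanned by e3 and e4, where e4 is
      annihilated by L, the product is given by two bilinear forms B (along e3)
      and C (along e4) on the plane of generators and by two covectors,
      x e3 = a(x) e4 and e3 x = b(x) e4 ([presented_two_generators]);
    - with one generator e1 and e2 = e1 e1, the products e1 e2 and e2 e1 span D2
      modulo a vector e4 annihilated by L, and six further scalars give the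
      product along e4 ([presented_one_generator]).

    Left symmetry is a system of polynomial equations on these constants. With
    two generators it says, for d = B(e1, e2) - B(e2, e1), that
    d b(z) = a(e1) B(e2, z) - a(e2) B(e1, z), and L is Novikov when each row of
    B is linearly dependent with b. The form B is brought to one of four normal
    forms up to congruence and scaling ([congruent_normal]). If B is symmetric
    then a = 0 or B has rank one, and b is normalized by the similitudes of B.
    If B is not symmetric then a determines b, and a is normalized by those
    similitudes; unless B is alternating they fix the isotropic lines of its
    symmetric part, which is where the square roots of 1 - 4 lambda come from.
    Finally C matters only modulo B and modulo the forms
    x, y |-> a(x) t(y) + t(x) b(y), obtained by adding multiples of e3 to the
    generators. The quotient is a line, so what is left of C is made 0 or 1 by
    rescaling; when B has rank one a coefficient of a is left as well, and the
    two generators are rescaled independently.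

    With one generator the whole basis is determined by e1 and the choice of e3
    and e4, and replacing e1 by x e1 + y e2 acts on the constants by an explicit
    substitution ([regenerate_left], [regenerate_right]). The parameter y kills
    one constant unless its coefficient vanishes, which is how the exceptional
    algebras of each family arise. *)

(** * Structure constants *)

Section Coordinates.
Variable K : fieldType.
Implicit Type A : algebra K.

(** Coordinates are nested pairs rather than row vectors so that they compute:
    an equality of coordinate vectors splits into four scalar identities. *)
Definition vec4 : Type := (K * K * K * K)%type.

Definition comb A (v1 v2 v3 v4 : A) (x : vec4) : A :=
  x.1.1.1 *: v1 + x.1.1.2 *: v2 + x.1.2 *: v3 + x.2 *: v4.

Definition presented A (M : vec4 -> vec4 -> vec4) : Prop :=
  exists v1 v2 v3 v4 : A, basis_of fullv [:: v1; v2; v3; v4] /\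
    forall x y,
      (comb v1 v2 v3 v4 x * comb v1 v2 v3 v4 y)%alg = comb v1 v2 v3 v4 (M x y).

Lemma combB A (v1 v2 v3 v4 : A) x y :
  comb v1 v2 v3 v4 (x - y) = comb v1 v2 v3 v4 x - comb v1 v2 v3 v4 y.
Proof.
rewrite /comb /= !scalerBl !opprD.
by do 3![rewrite [RHS]addrACA; congr (_ + _)].
Qed.

Lemma combD A (v1 v2 v3 v4 : A) x y :
  comb v1 v2 v3 v4 (x + y) = comb v1 v2 v3 v4 x + comb v1 v2 v3 v4 y.
Proof.
rewrite /comb /= !scalerDl.
by do 3![rewrite [RHS]addrACA; congr (_ + _)].
Qed.

Lemma combZ A (v1 v2 v3 v4 : A) k x :
  comb v1 v2 v3 v4 (k * x.1.1.1, k * x.1.1.2, k * x.1.2, k * x.2) =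
  k *: comb v1 v2 v3 v4 x.
Proof. by rewrite /comb /= !scalerDr !scalerA. Qed.

Lemma span_comb A (v1 v2 v3 v4 z : A) :
  reflect (exists x, z = comb v1 v2 v3 v4 x) (z \in <<[:: v1; v2; v3; v4]>>%VS).
Proof.
apply: (iffP idP) => [|[x ->]].
  rewrite !span_cons span_nil addv0.
  case/memv_addP => _ /vlineP[a ->] [? + ->].
  case/memv_addP => _ /vlineP[b ->] [? + ->].
  case/memv_addP => _ /vlineP[c ->] [? /vlineP[d ->] ->].
  by exists (a, b, c, d); rewrite /comb !addrA.
by rewrite /comb !rpredD // memvZ // memv_span // !inE eqxx ?orbT.
Qed.

Lemma basis_comb A (v1 v2 v3 v4 z : A) :
  basis_of fullv [:: v1; v2; v3; v4] -> exists x, z = comb v1 v2 v3 v4 x.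
Proof. by move=> bv; apply/span_comb; rewrite (span_basis bv) memvf. Qed.

Lemma comb_inj A (v1 v2 v3 v4 : A) :
  basis_of fullv [:: v1; v2; v3; v4] -> injective (comb v1 v2 v3 v4).
Proof.
move=> bv [[[x1 x2] x3] x4] [[[y1 y2] y3] y4] exy.
have /freeP fv : free (in_tuple [:: v1; v2; v3; v4]) by apply: basis_free bv.
pose k (i : 'I_4) := [:: x1 - y1; x2 - y2; x3 - y3; x4 - y4]`_i.
have k0 i : k i = 0.
  apply: fv; rewrite !big_ord_recl big_ord0 addr0 /k /= !addrA.
  have := combB v1 v2 v3 v4 (x1, x2, x3, x4) (y1, y2, y3, y4).
  by rewrite exy subrr.
by congr (_, _, _, _); apply/eqP; rewrite -subr_eq0; apply/eqP;
  [have := k0 0 | have := k0 1 | have := k0 2 | have := k0 3].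
Qed.

Lemma presented_left_symmetric A M x y z :
  presented A M -> left_symmetric A ->
  M (M x y) z - M x (M y z) = M (M y x) z - M y (M x z).
Proof.
case=> v1 [v2 [v3 [v4 [bv Mv]]]] lsA; apply: (comb_inj bv).
by rewrite !combB -!Mv lsA.
Qed.

Lemma presented_novikov A M :
  presented A M -> left_symmetric A ->
  (forall x y z, M (M x y) z = M (M x z) y) -> novikov A.
Proof.
case=> v1 [v2 [v3 [v4 [bv Mv]]]] lsA novM; split=> // x y z.
have [[x' ->] [y' ->]] := (basis_comb x bv, basis_comb y bv).
have [z' ->] := basis_comb z bv.
by rewrite !Mv novM.
Qed.

(** The bases used below are adapted to a flag of ideals: the new third vector is
    m e3 + n e4 and the new fourth one k e4. *)
Definition change (p q : vec4) (m n k : K) (x : vec4) : vec4 :=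
  let: (x1, x2, x3, x4) := x in
  let: (p1, p2, p3, p4) := p in
  let: (q1, q2, q3, q4) := q in
  (x1 * p1 + x2 * q1, x1 * p2 + x2 * q2, x1 * p3 + x2 * q3 + x3 * m,
   x1 * p4 + x2 * q4 + x3 * n + x4 * k).

Lemma change_surj p q m n k y :
  p.1.1.1 * q.1.1.2 - p.1.1.2 * q.1.1.1 != 0 -> m != 0 -> k != 0 ->
  exists x, y = change p q m n k x.
Proof.
case: p q y => [[[p1 p2] p3] p4] [[[q1 q2] q3] q4] [[[y1 y2] y3] y4] /= d0 m0 k0.
pose x1 := (y1 * q2 - y2 * q1) / (p1 * q2 - p2 * q1).
pose x2 := (y2 * p1 - y1 * p2) / (p1 * q2 - p2 * q1).
pose x3 := (y3 - x1 * p3 - x2 * q3) / m.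
exists (x1, x2, x3, (y4 - x1 * p4 - x2 * q4 - x3 * n) / k) => /=.
congr (_, _, _, _); last by field.
- by rewrite /x1 /x2; field.
- by rewrite /x1 /x2; field.
- by rewrite /x3; field.
Qed.

(** By dimension, a surjective change of coordinates comes from a basis. *)
Lemma rebase A M M' p q m n k :
  p.1.1.1 * q.1.1.2 - p.1.1.2 * q.1.1.1 != 0 -> m != 0 -> k != 0 ->
  (forall x y, M (change p q m n k x) (change p q m n k y) =
               change p q m n k (M' x y)) ->
  presented A M -> presented A M'.
Proof.
move=> d0 m0 k0 MM' [v1 [v2 [v3 [v4 [bv Mv]]]]].
set c := comb v1 v2 v3 v4 in Mv.
exists (c p), (c q), (c (0, 0, m, n)), (c (0, 0, 0, k)).
have cE x : comb (c p) (c q) (c (0, 0, m, n)) (c (0, 0, 0, k)) x =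
            c (change p q m n k x).
  case: x p q {d0 MM'} => [[[x1 x2] x3] x4] [[[p1 p2] p3] p4] [[[q1 q2] q3] q4].
  rewrite {1}/comb /= -!combZ -!combD; congr (c (_, _, _, _)) => /=; ring.
split; last by move=> x y; rewrite !cE Mv MM'.
rewrite basisEdim (size_basis bv) leqnn andbT; apply/subvP=> z _.
have [x ->] := basis_comb z bv; have [y ->] := change_surj n x d0 m0 k0.
by apply/span_comb; exists y; rewrite cE.
Qed.

Definition coords (x : 'rV[K]_4) : vec4 :=
  (coef x 1, coef x 2, coef x 3, coef x 4).

Lemma coords_inj : injective coords.
Proof.
move=> x y [e1 e2 e3 e4]; apply/rowP=> i.
have -> : i = inord i.+1.-1 by rewrite inord_val.
by case: i => -[|[|[|[|]]]].
Qed.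

Definition coord_row n (V : vectType K) (X : n.-tuple V) (v : V) : 'rV[K]_n :=
  \row_i coord X i v.

Fact coord_row_linear n (V : vectType K) (X : n.-tuple V) :
  linear (@coord_row n V X).
Proof. by move=> k u v; apply/rowP=> i; rewrite !mxE linearP. Qed.

HB.instance Definition _ n (V : vectType K) (X : n.-tuple V) :=
  GRing.isLinear.Build K V 'rV[K]_n *:%R (@coord_row n V X)
    (@coord_row_linear n V X).

Lemma presented_isomorphic A M t :
  presented A M ->
  (forall x y, coords (table_mul t x y) = M (coords x) (coords y)) ->
  isomorphic A (table_algebra t).
Proof.
case=> v1 [v2 [v3 [v4 [bv Mv]]]] tM.
pose X := [tuple v1; v2; v3; v4]; set c := comb v1 v2 v3 v4 in Mv.
pose f : 'Hom(A, table_algebra t) := linfun (coord_row X).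
have fK a : c (coords (f a)) = a.
  have aX : a \in <<X>>%VS by rewrite (span_basis bv) memvf.
  rewrite [RHS](coord_span aX) !big_ord_recl big_ord0 addr0 !addrA.
  rewrite /c /comb /coords /coef lfunE /= /coord_row !mxE.
  congr (_ + _ + _ + _); congr (_ *: _); congr (coord _ _ _);
    by apply: val_inj; rewrite /= inordK.
have cK x : f (c (coords x)) = x.
  by apply/coords_inj/(comb_inj bv); rewrite -/c fK.
exists f; first by exists (c \o coords).
move=> a b; rewrite -{1}[a]fK -{1}[b]fK Mv.
by rewrite -tM cK.
Qed.

Lemma coef_table_mul (t : table K) x y i :
  coef (table_mul t x y) i =
  \sum_(p <- t) coef x p.1.1 * coef y p.1.2 * coef p.2 i.
Proof. by rewrite /coef summxE; apply: eq_bigr => p _; rewrite mxE. Qed.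

Lemma coefZ k (x : 'rV[K]_4) i : coef (k *: x) i = k * coef x i :> K.
Proof. exact: mxE. Qed.

Lemma coefD (x y : 'rV[K]_4) i : coef (x + y) i = coef x i + coef y i :> K.
Proof. exact: mxE. Qed.

Lemma coefN (x : 'rV[K]_4) i : coef (- x) i = - coef x i :> K.
Proof. exact: mxE. Qed.

End Coordinates.

(** Compares a table with a structure map, coordinate by coordinate. The
    coordinates are generalized so that [ring] takes them as atoms. *)
Ltac check_table :=
  let x := fresh in let y := fresh in
  move=> x y; rewrite /coords !coef_table_mul !big_cons !big_nil /=;
  rewrite ?(coefZ, coefD, coefN) !coef_e //=;
  move: (coef x 1) (coef x 2) (coef x 3) (coef x 4) (coef y 1) (coef y 2)
    (coef y 3) (coef y 4) => *; congr (_, _, _, _); ring.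

Section Families.
Variable K : fieldType.

(** Bilinear forms on a plane, given by their Gram matrix. *)
Record form2 := Form { f11 : K; f12 : K; f21 : K; f22 : K }.

Definition ev (B : form2) (x1 x2 y1 y2 : K) : K :=
  f11 B * x1 * y1 + f12 B * x1 * y2 + f21 B * x2 * y1 + f22 B * x2 * y2.

Definition mul2gen (B C : form2) (a b : K * K) (x y : vec4 K) : vec4 K :=
  let: (x1, x2, x3, x4) := x in
  let: (y1, y2, y3, y4) := y in
  (0, 0, ev B x1 x2 y1 y2,
   ev C x1 x2 y1 y2 + (a.1 * x1 + a.2 * x2) * y3 + (b.1 * y1 + b.2 * y2) * x3).

(** The basis is e1, e2 = e1 e1, e3, e4; a and b are the coefficients of e1 e2
    and e2 e1 along e3, the other constants are coefficients along e4. *)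
Definition mul1gen (a b p q r s t u : K) (x y : vec4 K) : vec4 K :=
  let: (x1, x2, x3, x4) := x in
  let: (y1, y2, y3, y4) := y in
  (0, x1 * y1, a * x1 * y2 + b * x2 * y1,
   p * x1 * y2 + q * x2 * y1 + r * x2 * y2 + s * x1 * y3 + t * x3 * y1 +
   u * x2 * y3).

End Families.

(** Makes an equation that follows from u = v an identity provable by [ring]. *)
Lemma eq_of_sub (V : zmodType) (x y u v : V) : u = v -> x - y = u - v -> x = y.
Proof. by move=> ->; rewrite subrr => /eqP; rewrite subr_eq0 => /eqP. Qed.

(** * The descending series of a nilpotent left-symmetric algebra *)

Section Series.
Variable K : fieldType.
Implicit Types (A : algebra K).

Lemma add_line_dim (V : vectType K) (v : V) (W : {vspace V}) :
  v \notin W -> \dim (<[v]> + W) = (\dim W).+1.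
Proof.
move=> vW; apply/eqP; rewrite eqn_leq; apply/andP; split.
  apply: leq_trans (dimv_add_leqif _ _) _.
  by rewrite dim_vline; apply: leq_add (leq_b1 _) _.
rewrite ltn_neqAle dimvS ?addvSr // andbT; apply: contraNneq vW => dE.
have /eqP -> : W == (<[v]> + W)%VS by rewrite eqEdim addvSr dE leqnn.
by rewrite (subvP (addvSl _ _)) ?memv_line.
Qed.

Lemma add_line_eq (V : vectType K) (v : V) (U W : {vspace V}) :
  (W <= U)%VS -> v \in U -> v \notin W -> \dim U = (\dim W).+1 ->
  U = (<[v]> + W)%VS.
Proof.
move=> sWU vU vW dU; apply/esym/eqP; rewrite eqEdim add_line_dim // dU leqnn.
by rewrite andbT subv_add -memvE vU.
Qed.

Lemma mem_line2 (V : vectType K) (v w z : V) :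
  z \in (<[v]> + <[w]>)%VS -> exists c d, z = c *: v + d *: w.
Proof.
by case/memv_addP=> _ /vlineP[c ->] [_ /vlineP[d ->] ->]; exists c, d.
Qed.

Lemma basis_lines (V : vectType K) (v1 v2 v3 v4 : V) :
  \dim {:V} = 4 -> fullv = (<[v1]> + (<[v2]> + (<[v3]> + <[v4]>)))%VS ->
  basis_of fullv [:: v1; v2; v3; v4].
Proof.
move=> d4 fE; rewrite basisEdim d4 andbT !span_cons span_nil addv0.
by rewrite -fE subvv.
Qed.

(** The next term of the descending series, for U an ideal. *)
Definition descend A (U : {vspace A}) : {vspace A} :=
  (mulv U fullv + mulv fullv U)%VS.

Lemma mem_descendl A (U : {vspace A}) x y : x \in U -> (x * y)%alg \in descend U.
Proof.
move=> xU; apply: (subvP (addvSl _ _)).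
by apply: (mulvP U fullv _ (subvv _)); rewrite ?memvf.
Qed.

Lemma mem_descendr A (U : {vspace A}) x y : x \in U -> (y * x)%alg \in descend U.
Proof.
move=> xU; apply: (subvP (addvSr _ _)).
by apply: (mulvP fullv U _ (subvv _)); rewrite ?memvf.
Qed.

Lemma descend_sub A (U W : {vspace A}) :
  (forall x y, x \in U -> (x * y)%alg \in W /\ (y * x)%alg \in W) ->
  (descend U <= W)%VS.
Proof.
move=> UW; rewrite subv_add; apply/andP; split; apply/mulvP => x y xU yU.
  by case: (UW x y xU).
by case: (UW y x yU).
Qed.

Lemma descendS A (U W : {vspace A}) :
  (U <= W)%VS -> (descend U <= descend W)%VS.
Proof.
move=> /subvP sUW; apply: descend_sub => x y /sUW xW.
by rewrite mem_descendl ?mem_descendr.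
Qed.

(** By induction such a U lies in every power of A: if U is contained in A ^ k
    then U <= A ^ k A + A A ^ k <= A ^ (k + 1). *)
Lemma descend_stable A (U : {vspace A}) :
  nilpotent A -> (U <= descend U)%VS -> U = 0%VS.
Proof.
case=> [[|k]] // _ k0 sU; apply/eqP; rewrite -subv0 -k0.
elim: k {k0} => [|k IHk]; first by rewrite power1 subvf.
apply: subv_trans (subv_trans sU (descendS IHk)) _; apply: descend_sub => x y xk.
rewrite powerE //; split.
  rewrite big_nat_recr //= subSnn power1; apply: (subvP (addvSr _ _)).
  by apply: (mulvP _ _ _ (subvv _)); rewrite ?memvf.
rewrite big_ltn // subSS subn0 power1; apply: (subvP (addvSl _ _)).
by apply: (mulvP _ _ _ (subvv _)); rewrite ?memvf.
Qed.

Definition series A k : {vspace A} := iter k (@descend A) fullv.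

Lemma series_sub A k : (series A k.+1 <= series A k)%VS.
Proof. by elim: k => [|k IHk]; [apply: subvf | apply: descendS]. Qed.

Lemma descend_dim A (U : {vspace A}) : nilpotent A -> (descend U <= U)%VS ->
  (0 < \dim U)%N -> (\dim (descend U) < \dim U)%N.
Proof.
move=> nA sU U0; rewrite ltn_neqAle dimvS // andbT; apply: contraTneq U0 => dU.
rewrite lt0n negbK dimv_eq0 [U](descend_stable nA) //.
by have /eqP -> : descend U == U by rewrite eqEdim sU dU leqnn.
Qed.

(** Left symmetry reads u (x y) = (u x) y - (x u) y + x (u y), and each term on
    the right is obtained from u by two multiplications. *)
Lemma series_mul A k u w : left_symmetric A ->
  u \in series A k -> w \in series A 1 -> (u * w)%alg \in series A k.+2.
Proof.
move=> lsA uk w1.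
pose P := (linfun (amul A u) @^-1: series A k.+2)%VS.
suff /subvP/(_ w w1) : (series A 1 <= P)%VS by rewrite -memv_preim lfunE.
have uxy x y : (u * (x * y))%alg \in series A k.+2.
  rewrite -[(u * _)%alg](subKr ((u * x) * y)%alg) lsA.
  have ul z : (u * z)%alg \in series A k.+1 by apply: mem_descendl.
  have ur z : (z * u)%alg \in series A k.+1 by apply: mem_descendr.
  rewrite !rpredB //; [exact: mem_descendl (ul x) | exact: mem_descendl (ur x) |].
  exact: mem_descendr (ul y).
by apply: descend_sub => x y _; rewrite -!memv_preim !lfunE /= !uxy.
Qed.

(** Since descend U has dimension at most 1, the line of w is descend U itself
    if that is nonzero and any line of U otherwise; it is annihilated by A in
    both cases. *)
Lemma line_below A (U : {vspace A}) :
  nilpotent A -> (descend U <= U)%VS -> \dim U = 2%N ->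
  exists v w : A, [/\ U = (<[v]> + <[w]>)%VS, (descend U <= <[w]>)%VS &
                      descend <[w]> = 0%VS].
Proof.
move=> nA sU dU; have dd := descend_dim nA sU; rewrite dU in dd.
have {dd} d1 : (\dim (descend U) <= 1)%N by apply: dd.
have [w [w0 wU sw dw]] : exists w, [/\ w != 0, w \in U,
    (descend U <= <[w]>)%VS & descend <[w]> = 0%VS].
  have [U0|U0] := eqVneq (descend U) 0%VS.
    exists (vpick U); rewrite vpick0 -dimv_eq0 dU memv_pick U0 sub0v; split=> //.
    by apply/eqP; rewrite -subv0 -U0 descendS // -memvE memv_pick.
  have wE : (<[vpick (descend U)]> = descend U)%VS.
    apply/eqP; rewrite eqEdim -memvE memv_pick dim_vline vpick0 U0.
    by rewrite (leq_trans d1).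
  exists (vpick (descend U)); rewrite vpick0 U0 wE subvv.
  split=> //; first by rewrite (subvP sU) // memv_pick.
  apply/eqP; rewrite -dimv_eq0 -leqn0 -ltnS (leq_trans _ d1) //.
  by rewrite descend_dim ?descendS // lt0n dimv_eq0.
have /subvPn[v vU vw] : ~~ (U <= <[w]>)%VS.
  by apply/negP=> /dimvS; rewrite dU dim_vline; case: (w != 0).
exists v, w; split=> //; apply: add_line_eq vU vw _; rewrite -?memvE //.
by rewrite dU dim_vline w0.
Qed.

Lemma comb_mul A (v1 v2 v3 v4 : A) (x y : vec4 K) :
  let row v := y.1.1.1 *: (v * v1)%alg + y.1.1.2 *: (v * v2)%alg +
               y.1.2 *: (v * v3)%alg + y.2 *: (v * v4)%alg in
  (comb v1 v2 v3 v4 x * comb v1 v2 v3 v4 y)%alg =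
  x.1.1.1 *: row v1 + x.1.1.2 *: row v2 + x.1.2 *: row v3 + x.2 *: row v4.
Proof.
have rowE v : (v * comb v1 v2 v3 v4 y)%alg =
    y.1.1.1 *: (v * v1)%alg + y.1.1.2 *: (v * v2)%alg +
    y.1.2 *: (v * v3)%alg + y.2 *: (v * v4)%alg.
  by rewrite /comb !linearDr !linearZr_LR.
by move=> row; rewrite {1}/comb !linearDl !linearZl_LR /= !rowE.
Qed.

(** Here D1 is spanned by v3 and v4, with D2 in the line of v4 and v4
    annihilated by A; moreover v3 v3 lies in D1 D1 <= D3 = 0. *)
Lemma presented_two_generators A :
  left_symmetric A -> nilpotent A -> \dim {:A} = 4 -> \dim (series A 1) = 2%N ->
  exists B C a b, presented A (mul2gen B C a b).
Proof.
move=> lsA nA d4 d2.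
have [v3 [v4 [D1 D2 D3]]] :=
    line_below (U := series A 1) nA (series_sub A 1) d2.
have /subvPn[v2 _ v2D] : ~~ (fullv <= series A 1)%VS.
  by apply/negP=> /dimvS; rewrite d4 d2.
have dW := add_line_dim v2D; rewrite d2 in dW.
have /subvPn[v1 _ v1W] : ~~ (fullv <= <[v2]> + series A 1)%VS.
  by apply/negP=> /dimvS; rewrite d4 dW.
have bv : basis_of fullv [:: v1; v2; v3; v4].
  apply: basis_lines => //; rewrite -D1; apply: add_line_eq => //.
  - exact: subvf.
  - exact: memvf.
  - by rewrite d4 dW.
have v4l z : (v4 * z)%alg = 0.
  by apply/eqP; rewrite -memv0 -D3 mem_descendl // memv_line.
have v4r z : (z * v4)%alg = 0.
  by apply/eqP; rewrite -memv0 -D3 mem_descendr // memv_line.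
have v3D : v3 \in series A 1.
  by rewrite D1 (subvP (addvSl _ _)) // memv_line.
have v33 : (v3 * v3)%alg = 0.
  apply/eqP; rewrite -memv0 -D3 (subvP (descendS D2)) //.
  exact: (@series_mul A 1).
pose c := comb v1 v2 v3 v4.
have prod x y : exists m n, (x * y)%alg = c (0, 0, m, n).
  have : (x * y)%alg \in series A 1 by rewrite mem_descendl // memvf.
  rewrite D1 => /mem_line2[m [n ->]]; exists m, n.
  by rewrite /c /comb /= !scale0r !add0r.
have prod3 y : exists n, (v3 * y)%alg = c (0, 0, 0, n).
  have /(subvP D2)/vlineP[n ->] : (v3 * y)%alg \in descend (series A 1).
    exact: mem_descendl.
  by exists n; rewrite /c /comb /= !scale0r !add0r.
have prod3' y : exists n, (y * v3)%alg = c (0, 0, 0, n).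
  have /(subvP D2)/vlineP[n ->] : (y * v3)%alg \in descend (series A 1).
    exact: mem_descendr.
  by exists n; rewrite /c /comb /= !scale0r !add0r.
have [B11 [C11 e11]] := prod v1 v1; have [B12 [C12 e12]] := prod v1 v2.
have [B21 [C21 e21]] := prod v2 v1; have [B22 [C22 e22]] := prod v2 v2.
have [a1 e13] := prod3' v1; have [a2 e23] := prod3' v2.
have [b1 e31] := prod3 v1; have [b2 e32] := prod3 v2.
exists (Form B11 B12 B21 B22), (Form C11 C12 C21 C22), (a1, a2), (b1, b2).
exists v1, v2, v3, v4; split=> // x y.
rewrite comb_mul !v4l !v4r v33 e11 e12 e13 e21 e22 e23 e31 e32 /=.
rewrite !(scaler0, addr0) /c -!combZ -!combD -!combZ -!combD.
case: x y => [[[x1 x2] x3] x4] [[[y1 y2] y3] y4] /=.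
by congr (comb _ _ _ _ (_, _, _, _)); rewrite /ev /=; ring.
Qed.

(** Here D1 = <v1 v1> + D2, so D2 is a plane, from which [line_below] picks v3
    and v4. The products v3 v2 and v3 v3 lie in D2 D1 <= D4 = 0. If
    neither v1 v2 nor v2 v1 involved v3 then D2 would be the line of v4. *)
Lemma presented_one_generator A :
  left_symmetric A -> nilpotent A -> \dim {:A} = 4 -> \dim (series A 1) = 3%N ->
  exists a b p q r s t u, presented A (mul1gen a b p q r s t u) /\
    (a != 0) || (b != 0).
Proof.
move=> lsA nA d4 d1.
have /subvPn[v1 _ v1D] : ~~ (fullv <= series A 1)%VS.
  by apply/negP=> /dimvS; rewrite d4 d1.
have fE : fullv = (<[v1]> + series A 1)%VS.
  by apply: add_line_eq => //; rewrite ?subvf ?memvf // d4 d1.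
have decomp z : exists m w, w \in series A 1 /\ z = m *: v1 + w.
  have : z \in (<[v1]> + series A 1)%VS by rewrite -fE memvf.
  by case/memv_addP=> _ /vlineP[m ->] [w wD ->]; exists m, w.
pose v2 := (v1 * v1)%alg.
have v2D : v2 \in series A 1 by rewrite mem_descendl // memvf.
have D1le : (series A 1 <= <[v2]> + series A 2)%VS.
  have sub x y : (x * y)%alg \in (<[v2]> + series A 2)%VS.
    have [m [x' [xD ->]]] := decomp x; have [n [y' [yD ->]]] := decomp y.
    rewrite linearDl linearZl_LR linearDr linearZr_LR /= scalerDr scalerA.
    rewrite -addrA memv_add ?memvZ ?memv_line // rpredD ?memvZ //.
      exact: mem_descendr.
    exact: mem_descendl.
  by apply: descend_sub.
have d2 : \dim (series A 2) = 2%N.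
  apply/eqP; rewrite eqn_leq; apply/andP; split.
    by rewrite -ltnS -d1 descend_dim ?d1 // (series_sub A 1).
  rewrite -ltnS -d1; apply: leq_trans (dimvS D1le) _.
  apply: leq_trans (dimv_add_leqif _ _) _.
  by rewrite dim_vline; apply: leq_add (leq_b1 _) _.
have v2N : v2 \notin series A 2.
  apply/negP=> v2N; have /dimvS : (series A 1 <= series A 2)%VS.
    by apply: subv_trans D1le _; rewrite subv_add -memvE v2N subvv.
  by rewrite d1 d2.
have D1 : series A 1 = (<[v2]> + series A 2)%VS.
  by apply: add_line_eq; rewrite ?d1 ?d2 // (series_sub A 1).
have [v3 [v4 [D2 D3 D4]]] :=
    line_below (U := series A 2) nA (series_sub A 2) d2.
have bv : basis_of fullv [:: v1; v2; v3; v4].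
  by apply: basis_lines => //; rewrite -D2 -D1.
have v4l z : (v4 * z)%alg = 0.
  by apply/eqP; rewrite -memv0 -D4 mem_descendl // memv_line.
have v4r z : (z * v4)%alg = 0.
  by apply/eqP; rewrite -memv0 -D4 mem_descendr // memv_line.
have v3D : v3 \in series A 2.
  by rewrite D2 (subvP (addvSl _ _)) // memv_line.
have v3D1 : v3 \in series A 1 by apply: (subvP (series_sub A 1)).
have v3r z : z \in series A 1 -> (v3 * z)%alg = 0.
  move=> zD; apply/eqP; rewrite -memv0 -D4 (subvP (descendS D3)) //.
  exact: (@series_mul A 2).
pose c := comb v1 v2 v3 v4.
have prod2 z : z \in series A 2 -> exists m n, z = c (0, 0, m, n).
  rewrite D2 => /mem_line2[m [n ->]]; exists m, n.
  by rewrite /c /comb /= !scale0r !add0r.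
have prod3 z : z \in series A 3 -> exists n, z = c (0, 0, 0, n).
  move=> /(subvP D3)/vlineP[n ->].
  by exists n; rewrite /c /comb /= !scale0r !add0r.
have [a [p e12]] : exists a p, (v1 * v2)%alg = c (0, 0, a, p).
  by apply: prod2; apply: mem_descendr.
have [b [q e21]] : exists b q, (v2 * v1)%alg = c (0, 0, b, q).
  by apply: prod2; apply: mem_descendl.
have [r e22] : exists r, (v2 * v2)%alg = c (0, 0, 0, r).
  by apply: prod3; apply: (@series_mul A 1).
have [s e13] : exists s, (v1 * v3)%alg = c (0, 0, 0, s).
  by apply: prod3; apply: mem_descendr.
have [t e31] : exists t, (v3 * v1)%alg = c (0, 0, 0, t).
  by apply: prod3; apply: mem_descendl.
have [u e23] : exists u, (v2 * v3)%alg = c (0, 0, 0, u).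
  by apply: prod3; apply: mem_descendr.
have e11 : (v1 * v1)%alg = c (0, 1, 0, 0).
  by rewrite /c /comb /= !scale0r !add0r !addr0 scale1r.
exists a, b, p, q, r, s, t, u; split.
  exists v1, v2, v3, v4; split=> // x y.
  rewrite comb_mul !v4l !v4r (v3r _ v2D) (v3r _ v3D1).
  rewrite e11 e12 e13 e21 e22 e23 e31 /=.
  rewrite !(scaler0, addr0) /c -!combZ -!combD -!combZ -!combD.
  case: x y => [[[x1 x2] x3] x4] [[[y1 y2] y3] y4] /=.
  by congr (comb _ _ _ _ (_, _, _, _)) => /=; ring.
rewrite -negb_and; apply/negP=> /andP[/eqP a0 /eqP b0].
have line n : c (0, 0, 0, n) \in <[v4]>%VS.
  by rewrite /c /comb /= !scale0r !add0r memvZ // memv_line.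
have /dimvS : (series A 2 <= <[v4]>)%VS.
  apply: (@descend_sub A (series A 1)) => x y xD.
  have [x1l x1r] : (x * v1)%alg \in <[v4]>%VS /\ (v1 * x)%alg \in <[v4]>%VS.
    move: xD; rewrite D1 => /memv_addP[_ /vlineP[n ->] [x' x'D ->]].
    rewrite linearDl linearDr linearZl_LR linearZr_LR /= e12 e21 a0 b0.
    by split; rewrite rpredD ?memvZ //; apply: (subvP D3);
      [apply: mem_descendl | apply: mem_descendr].
  have [m [y' [yD ->]]] := decomp y.
  rewrite linearDl linearDr linearZl_LR linearZr_LR /=.
  by split; rewrite rpredD ?memvZ //; apply: (subvP D3); apply: (@series_mul A 1).
by rewrite d2 dim_vline; case: (v4 != 0).
Qed.

Lemma small_square_novikov A :
  left_symmetric A -> nilpotent A -> (\dim (series A 1) <= 1)%N -> novikov A.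
Proof.
move=> lsA nA d1; have D2 : series A 2 = 0%VS.
  have [d0|d0] := posnP (\dim (series A 1)).
    apply/eqP; rewrite -dimv_eq0 -leqn0.
    by apply: leq_trans (dimvS (series_sub A 1)) _; rewrite d0.
  apply/eqP; rewrite -dimv_eq0 -leqn0 -ltnS (leq_trans _ d1) //.
  exact: descend_dim nA (series_sub A 1) d0.
have xyz (x y z : A) : ((x * y) * z)%alg = 0.
  apply/eqP; rewrite -memv0 -D2 mem_descendl // mem_descendl //.
  exact: memvf.
by split=> // x y z; rewrite !xyz.
Qed.

End Series.

(** * One generator *)

Section OneGenerator.
Variables (R : realType) (sqrt : R[i] -> R[i]).
Local Notation K := (R[i]).
Implicit Types (A : algebra K) (p q s t u k : K).

Definition classified A : Prop :=
  exists2 t : table K, listed sqrt t & isomorphic A (table_algebra t).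

Lemma presented_classified A M (t : table K) :
  presented A M -> listed sqrt t ->
  (forall x y : 'rV[K]_4, coords (table_mul t x y) = M (coords x) (coords y)) ->
  classified A.
Proof. by move=> pA lt tM; exists t => //; apply: presented_isomorphic pA tM. Qed.

(** The generator becomes x e1 + y e2, and e2 = e1 e1, e3 = e2 e1 are recomputed
    from it, while e4 is multiplied by k. The relation r = s + t for the
    coefficient r of e2 e2 is left symmetry. *)
Lemma regenerate_left A p s t u (x y : K) k p' s' t' u' :
  presented A (mul1gen 0 1 p 0 (s + t) s t u) -> x != 0 -> k != 0 ->
  k * p' = x ^+ 3 * p + x ^+ 2 * y * (2 * s + t) + x * y ^+ 2 * u ->
  k * s' = x ^+ 4 * s + x ^+ 3 * y * u ->
  k * t' = x ^+ 4 * t ->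
  k * u' = x ^+ 5 * u ->
  presented A (mul1gen 0 1 p' 0 (s' + t') s' t' u').
Proof.
move=> pA x0 k0 ep es et eu.
apply: (@rebase _ A _ _ (x, y, 0, 0)
  (0, x ^+ 2, x * y, x * y * p + y ^+ 2 * (s + t))
  (x ^+ 3) (x ^+ 2 * y * (s + t) + x ^+ 2 * y * t) k) pA => //=.
- by rewrite mulr0 subr0 !mulf_neq0 // expf_neq0.
- by rewrite expf_neq0.
move=> [[[x1 x2] x3] x4] [[[y1 y2] y3] y4]; rewrite /mul1gen /change.
rewrite (canRL (mulKf k0) ep) (canRL (mulKf k0) es) (canRL (mulKf k0) et).
rewrite (canRL (mulKf k0) eu); congr (_, _, _, _); by field.
Qed.

(** The same change of generator when e3 is e1 e2, so that e2 e1 = l e3 + q e4;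
    left symmetry gives e2 e2 = (l (s + t) - t) e4. *)
Lemma regenerate_right A (l : K) q s t (x y : K) k q' s' t' :
  presented A (mul1gen 1 l 0 q (l * (s + t) - t) s t 0) -> x != 0 -> k != 0 ->
  k * q' = x ^+ 3 * q +
    x ^+ 2 * y * ((1 - l) * (l * (s + t) - t) + (1 + l) * (t - l * s)) ->
  k * s' = x ^+ 4 * s ->
  k * t' = x ^+ 4 * t ->
  presented A (mul1gen 1 l 0 q' (l * (s' + t') - t') s' t' 0).
Proof.
move=> pA x0 k0 eq es et.
apply: (@rebase _ A _ _ (x, y, 0, 0)
  (0, x ^+ 2, x * y * (1 + l), x * y * q + y ^+ 2 * (l * (s + t) - t))
  (x ^+ 3) (x ^+ 2 * y * ((1 + l) * s + l * (s + t) - t)) k) pA => //=.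
- by rewrite mulr0 subr0 !mulf_neq0 // expf_neq0.
- by rewrite expf_neq0.
move=> [[[x1 x2] x3] x4] [[[y1 y2] y3] y4]; rewrite /mul1gen /change.
rewrite (canRL (mulKf k0) eq) (canRL (mulKf k0) es) (canRL (mulKf k0) et).
by congr (_, _, _, _); field.
Qed.

(** If u is nonzero then y is used to cancel s + t, the coefficient of e2 e2;
    rescaling by x then normalizes p or, failing that, t. If u = 0 the algebra
    is Novikov when s + t = 0; otherwise s + t is scaled to 1, and then y adds
    (s + 1) y to p, which isolates s = -1. *)
Lemma classify_left A p s t u :
  presented A (mul1gen 0 1 p 0 (s + t) s t u) -> left_symmetric A ->
  novikov A \/ classified A.
Proof.
move=> pA lsA; have [u0|u0] := eqVneq u 0; last first.
  right.
  have {p s t u u0 pA} [p [t pA]] :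
      exists p t, presented A (mul1gen 0 1 p 0 (- t + t) (- t) t 1).
    have yu : - (s + t) / u * u = - (s + t) by field.
    exists ((p - (s + t) / u * s) / u), (t / u).
    apply: (@regenerate_left A p s t u 1 (- (s + t) / u) u _ _ _ _ pA) => //;
      by [exact: oner_neq0 | field].
  have [p0|p0] := eqVneq p 0; last first.
    pose x : K := sqrtC p; have x2 : x ^+ 2 = p by rewrite sqrtCK.
    have x0 : x != 0 by rewrite sqrtC_eq0.
    have {}pA : presented A
        (mul1gen 0 1 1 0 (- (t / x) + t / x) (- (t / x)) (t / x) 1).
      apply: (@regenerate_left A p (- t) t 1 x 0 (x ^+ 5) _ _ _ _ pA x0);
        rewrite ?expf_neq0 //; by [ring: x2 | field].
    apply: presented_classified pA (L4_21 _ (- (t / x))) _; rewrite /mul1gen.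
    check_table.
  subst p; have [t0|t0] := eqVneq t 0.
    subst t; apply: presented_classified pA (L4_19 _) _; rewrite /mul1gen.
    check_table.
  have {}pA : presented A (mul1gen 0 1 0 0 (1 - 1) 1 (- 1) 1).
    apply: (@regenerate_left A 0 (- t) t 1 (- t) 0 (- t ^+ 5) _ _ _ _ pA);
      rewrite ?oppr_eq0 ?expf_neq0 //; by ring.
  apply: presented_classified pA (L4_20 _) _; rewrite /mul1gen.
  check_table.
subst u; have [sE|st0] := eqVneq s (- t).
  subst s.
  left; apply: presented_novikov pA lsA _.
  move=> [[[x1 x2] x3] x4] [[[y1 y2] y3] y4] [[[z1 z2] z3] z4]; rewrite /mul1gen.
  by congr (_, _, _, _); ring.
right; rewrite -addr_eq0 in st0.
have {p s t st0 pA} [p [s pA]] :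
    exists p s, presented A (mul1gen 0 1 p 0 (s + (1 - s)) s (1 - s) 0).
  exists (p / (s + t)), (s / (s + t)).
  apply: (@regenerate_left A p s t 0 1 0 (s + t) _ _ _ _ pA) => //;
    by [exact: oner_neq0 | field].
have [sE|s1] := eqVneq s (- 1); last first.
  rewrite -addr_eq0 addrC in s1.
  have {}pA : presented A (mul1gen 0 1 0 0 (s + (1 - s)) s (1 - s) 0).
    apply: (@regenerate_left A p s (1 - s) 0 1 (- p / (1 + s)) 1 _ _ _ _ pA);
      rewrite ?oner_neq0 //; by field.
  apply: presented_classified pA (L4_17 _ s) _; rewrite /mul1gen.
  check_table.
subst s; have [p0|p0] := eqVneq p 0.
  subst p; apply: presented_classified pA (L4_17 _ (- 1)) _; rewrite /mul1gen.
  check_table.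
have {}pA : presented A (mul1gen 0 1 1 0 (- 1 + 2) (- 1) 2 0).
  apply: (@regenerate_left A p (- 1) (1 - - 1) 0 p 0 (p ^+ 4) _ _ _ _ pA);
    rewrite ?expf_neq0 //; by ring.
apply: presented_classified pA (L4_18 _) _; rewrite /mul1gen.
check_table.
Qed.

(** The algebra is Novikov when r = t for r = l (s + t) - t. Otherwise scaling
    r - t to 2 leaves the parameter a = (s + t) / 2, and the change of generator
    by y moves q by a multiple of c = - l (l (1 - l) a + l + 3). Hence q can be
    cancelled unless l = 0 or a takes one value determined by l. *)
Lemma classify_right A (l : K) q s t :
  presented A (mul1gen 1 l 0 q (l * (s + t) - t) s t 0) -> left_symmetric A ->
  novikov A \/ classified A.
Proof.
move=> pA lsA; have [rt|rt] := eqVneq (l * (s + t) - t) t.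
  left; rewrite rt in pA; apply: presented_novikov pA lsA _.
  move=> [[[x1 x2] x3] x4] [[[y1 y2] y3] y4] [[[z1 z2] z3] z4]; rewrite /mul1gen.
  by congr (_, _, _, _); ring.
right; rewrite -subr_eq0 in rt.
have {q s t rt pA} [q [a pA]] : exists q a, let s := (2 - l) * a + 1 in
    let t := l * a - 1 in presented A (mul1gen 1 l 0 q (l * (s + t) - t) s t 0).
  pose c := l * (s + t) - t - t.
  exists (2 * q / c), ((s + t) / c).
  apply: (@regenerate_right A l q s t 1 0 (c / 2) _ _ _ pA);
    rewrite ?oner_neq0 ?mulf_neq0 ?invr_eq0 ?pnatr_eq0 // /c; by field.
pose s : K := (2 - l) * a + 1; pose t : K := l * a - 1.
have {}pA : presented A (mul1gen 1 l 0 q (l * (s + t) - t) s t 0) := pA.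
pose c := (1 - l) * (l * (s + t) - t) + (1 + l) * (t - l * s).
have cE : c = - l * (l * (1 - l) * a + l + 3) by rewrite /c /s /t; ring.
have [q0|q0] := eqVneq (q * c) 0; last first.
  have c0 : c != 0 by move: q0; rewrite mulf_eq0 negb_or => /andP[].
  have {}pA : presented A (mul1gen 1 l 0 0 (l * (s + t) - t) s t 0).
    apply: (@regenerate_right A l q s t 1 (- q / c) 1 _ _ _ pA);
      rewrite ?oner_neq0 // -/c; by field.
  apply: presented_classified pA (L4_23 _ l a) _; rewrite /mul1gen /s /t.
  check_table.
have [q1|q1] := eqVneq q 0.
  rewrite q1 in pA.
  apply: presented_classified pA (L4_23 _ l a) _; rewrite /mul1gen /s /t.
  check_table.
(* From here on c = 0, so q is only rescaled. *)
have [l0|l0] := eqVneq l 0.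
  have {}pA : presented A (mul1gen 1 l 0 1 (l * (s + t) - t) s t 0).
    apply: (@regenerate_right A l q s t q 0 (q ^+ 4) _ _ _ pA);
      rewrite ?expf_neq0 //; by ring.
  rewrite /s /t l0 in pA.
  apply: presented_classified pA (L4_22 _ a) _; rewrite /mul1gen.
  check_table.
have {q0} aE : l * (1 - l) * a + l + 3 = 0.
  by apply/eqP; move/eqP: q0; rewrite cE !mulf_eq0 oppr_eq0 (negPf q1) (negPf l0).
have l1 : l != 1.
  apply: contra_eq_neq aE => ->.
  by rewrite subrr mulr0 mul0r add0r -(natrD _ 1 3) pnatr_eq0.
have l1' : l - 1 != 0 by rewrite subr_eq0.
have {aE} aE : a = (l + 3) / (l * (l - 1)).
  apply: (mulIf (mulf_neq0 l0 l1')); rewrite divfK ?mulf_neq0 //.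
  by rewrite -[LHS]addr0 -aE; ring.
pose x : K := q * (l * (l - 1)).
have {}pA : presented A (mul1gen 1 l 0 1 (l * (2 * (3 - l) + 4 * l) - 4 * l)
                         (2 * (3 - l)) (4 * l) 0).
  apply: (@regenerate_right A l q s t x 0 (x ^+ 4 / (l * (l - 1))) _ _ _ pA);
    rewrite ?mulf_neq0 ?invr_eq0 ?expf_neq0 ?mulf_neq0 // /x /s /t ?aE; field;
    by rewrite l0 l1'.
apply: presented_classified pA (L4_24 _ l0 l1) _; rewrite /mul1gen.
check_table.
Qed.

(** Left symmetry on (e1, e2, e1) computes r, and on (e1, e2, e2) it gives
    a u = 0. The vector e3 is taken as e1 e2 if a is nonzero, as e2 e1 if not. *)
Lemma classify_one_generator A (a b : K) p q (r : K) s t u :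
  presented A (mul1gen a b p q r s t u) -> left_symmetric A ->
  (a != 0) || (b != 0) -> novikov A \/ classified A.
Proof.
move=> pA lsA ab0.
pose e1 : vec4 K := (1, 0, 0, 0); pose e2 : vec4 K := (0, 1, 0, 0).
have ls1 := presented_left_symmetric e1 e2 e1 pA lsA.
have ls2 := presented_left_symmetric e1 e2 e2 pA lsA.
have {ls1} rE : r = b * (s + t) - a * t.
  by apply: (eq_of_sub (congr1 snd ls1)); rewrite /mul1gen /=; ring.
have {ls2} au : a * u = 0.
  by apply: (eq_of_sub (congr1 snd ls2)); rewrite /mul1gen /=; ring.
have [a0|a0] := eqVneq a 0; last first.
  have u0 : u = 0 by move/eqP: au; rewrite mulf_eq0 (negPf a0) => /eqP.
  apply: (@classify_right A (b / a) (q - b / a * p) (a * s) (a * t)) lsA.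
  apply: (@rebase _ A _ _ (1, 0, 0, 0) (0, 1, 0, 0) a p 1 _ a0 _ _ pA) => /=;
    rewrite ?mulr0 ?subr0 ?mulr1 ?oner_neq0 // u0 rE.
  move=> [[[x1 x2] x3] x4] [[[y1 y2] y3] y4]; rewrite /mul1gen /change.
  by congr (_, _, _, _); field.
rewrite a0 eqxx in rE pA ab0 => {au a0}.
apply: (@classify_left A p (b * s) (b * t) (b * u)) lsA.
apply: (@rebase _ A _ _ (1, 0, 0, 0) (0, 1, 0, 0) b q 1 _ ab0 _ _ pA) => /=;
  rewrite ?mulr0 ?subr0 ?mulr1 ?oner_neq0 // rE.
move=> [[[x1 x2] x3] x4] [[[y1 y2] y3] y4]; rewrite /mul1gen /change.
by congr (_, _, _, _); ring.
Qed.

End OneGenerator.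

(** * Two generators *)

Section TwoGenerators.
Variables (R : realType) (sqrt : R[i] -> R[i]).
Local Notation K := (R[i]).
Implicit Types (A : algebra K) (B C : form2 K) (a b : K * K) (s l c : K).
Local Notation classified := (classified sqrt).

Lemma mul2gen_left_symmetric A B C a b :
  presented A (mul2gen B C a b) -> left_symmetric A ->
  (f12 B - f21 B) * b.1 = a.1 * f21 B - a.2 * f11 B /\
  (f12 B - f21 B) * b.2 = a.1 * f22 B - a.2 * f12 B.
Proof.
move=> pA lsA; pose e1 : vec4 K := (1, 0, 0, 0); pose e2 : vec4 K := (0, 1, 0, 0).
by split; [have := presented_left_symmetric e1 e2 e1 pA lsA
         | have := presented_left_symmetric e1 e2 e2 pA lsA];
  move=> /(congr1 snd)/eq_of_sub; apply; rewrite /mul2gen /ev /=; ring.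
Qed.

Lemma mul2gen_novikov A B C a b :
  presented A (mul2gen B C a b) -> left_symmetric A ->
  f11 B * b.2 = f12 B * b.1 -> f21 B * b.2 = f22 B * b.1 -> novikov A.
Proof.
move=> pA lsA h1 h2; apply: presented_novikov pA lsA _.
move=> [[[x1 x2] x3] x4] [[[y1 y2] y3] y4] [[[z1 z2] z3] z4]; rewrite /mul2gen /ev.
congr (_, _, _, _); try ring.
pose d : K := y1 * z2 - y2 * z1.
suff : x1 * d * (f11 B * b.2) + x2 * d * (f21 B * b.2) =
       x1 * d * (f12 B * b.1) + x2 * d * (f22 B * b.1).
  by move/eq_of_sub; apply; rewrite /d; ring.
by rewrite h1 h2.
Qed.

(** The normal forms of nonzero bilinear forms on a plane, up to congruence and
    scaling. *)
Inductive normal_form : form2 K -> Prop :=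
| NormalSquare : normal_form (Form 1 0 0 0)
| NormalSum : normal_form (Form 1 0 0 1)
| NormalSkew : normal_form (Form 0 1 (- 1) 0)
| NormalGeneric l : normal_form (Form l 0 1 1).

Definition congruent B B' : Prop := exists p1 p2 q1 q2 m : K,
  [/\ p1 * q2 - p2 * q1 != 0, m != 0 &
   forall x1 x2 y1 y2, ev B (x1 * p1 + x2 * q1) (x1 * p2 + x2 * q2)
     (y1 * p1 + y2 * q1) (y1 * p2 + y2 * q2) = m * ev B' x1 x2 y1 y2].

(** A form that is not alternating has a vector u with m = B(u, u) nonzero. If B
    is symmetric, u is completed by an orthogonal vector, rescaled by a square
    root when it is not isotropic. If not, u is taken as the second basis vector
    and the first one is q with B(q, u) = 0, scaled so that B(u, q) = m: this is
    possible because B(u, q) - B(q, u) is a nonzero multiple of det(u, q). *)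
Lemma congruent_normal B :
  B = Form 0 0 0 0 \/ exists2 B', normal_form B' & congruent B B'.
Proof.
case: B => B11 B12 B21 B22; pose B := Form B11 B12 B21 B22.
have [[u1 [u2 m0]]|alt] : (exists u1 u2, ev B u1 u2 u1 u2 != 0) \/
    [/\ B11 = 0, B22 = 0 & B21 = - B12].
  have [e11|] := eqVneq (ev B 1 0 1 0) 0; last by left; exists 1, 0.
  have [e22|] := eqVneq (ev B 0 1 0 1) 0; last by left; exists 0, 1.
  have [e12|] := eqVneq (ev B 1 1 1 1) 0; last by left; exists 1, 1.
  have B1 : B11 = 0 by rewrite -e11 /ev /=; ring.
  have B2 : B22 = 0 by rewrite -e22 /ev /=; ring.
  right; split=> //; apply: (eq_of_sub e12).
  by rewrite /ev /= B1 B2; ring.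
- set m := ev B u1 u2 u1 u2 in m0; right.
  have mE : m = ev B u1 u2 u1 u2 by [].
  have [sym|asym] := eqVneq B12 B21.
    subst B21.
    pose q1 := - (B12 * u1 + B22 * u2); pose q2 := B11 * u1 + B12 * u2.
    pose n := ev B q1 q2 q1 q2.
    have d0 : u1 * q2 - u2 * q1 != 0.
      by apply: contra_neq m0 => d0; rewrite -d0 mE /ev /q1 /q2 /=; ring.
    have BE r x1 x2 y1 y2 :
        ev B (x1 * u1 + x2 * (r * q1)) (x1 * u2 + x2 * (r * q2))
             (y1 * u1 + y2 * (r * q1)) (y1 * u2 + y2 * (r * q2)) =
        m * (x1 * y1) + r ^+ 2 * n * (x2 * y2).
      by rewrite /n mE /ev /q1 /q2 /=; ring.
    have [n0|n0] := eqVneq n 0.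
      exists (Form 1 0 0 0); first exact: NormalSquare.
      exists u1, u2, (1 * q1), (1 * q2), m; split=> //; first by rewrite !mul1r.
      by move=> x1 x2 y1 y2; rewrite BE n0 /ev /=; ring.
    pose r : K := sqrtC (m / n).
    have r2 : r ^+ 2 * n = m by rewrite sqrtCK divfK.
    have r0 : r != 0 by rewrite sqrtC_eq0 mulf_neq0 ?invr_eq0.
    exists (Form 1 0 0 1); first exact: NormalSum.
    exists u1, u2, (r * q1), (r * q2), m; split=> //.
      by rewrite mulrCA (mulrCA u2) -mulrBr mulf_neq0.
    by move=> x1 x2 y1 y2; rewrite BE r2 /ev /=; ring.
  rewrite -subr_eq0 in asym.
  pose q1 : K := - (B21 * u1 + B22 * u2) / (B12 - B21).
  pose q2 : K := (B11 * u1 + B12 * u2) / (B12 - B21).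
  exists (Form (ev B q1 q2 q1 q2 / m) 0 1 1); first exact: NormalGeneric.
  exists q1, q2, u1, u2, m; split=> //.
    have -> : q1 * u2 - q2 * u1 = - m / (B12 - B21).
      by rewrite mE /ev /q1 /q2 /=; field.
    by rewrite mulf_neq0 ?oppr_eq0 ?invr_eq0.
  have evE l x1 x2 y1 y2 : m * ev (Form (l / m) 0 1 1) x1 x2 y1 y2 =
      l * (x1 * y1) + m * (x2 * y1) + m * (x2 * y2).
    by rewrite /ev /=; field.
  by move=> x1 x2 y1 y2; rewrite evE mE /ev /q1 /q2 /=; field.
have [-> -> ->] := alt.
have [->|c0] := eqVneq B12 0; first by left; rewrite oppr0.
right; exists (Form 0 1 (- 1) 0); first exact: NormalSkew.
exists 1, 0, 0, 1, B12; split=> //; first by rewrite !mulr1 mulr0 subr0 oner_neq0.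
by move=> x1 x2 y1 y2; rewrite /ev /=; ring.
Qed.

Lemma congruent_presented A B B' C a b :
  presented A (mul2gen B C a b) -> congruent B B' ->
  exists C' a' b', presented A (mul2gen B' C' a' b').
Proof.
move=> pA [p1 [p2 [q1 [q2 [m [d0 m0 BB']]]]]].
exists (Form (ev C p1 p2 p1 p2) (ev C p1 p2 q1 q2)
             (ev C q1 q2 p1 p2) (ev C q1 q2 q1 q2)).
exists (m * (a.1 * p1 + a.2 * p2), m * (a.1 * q1 + a.2 * q2)).
exists (m * (b.1 * p1 + b.2 * p2), m * (b.1 * q1 + b.2 * q2)).
apply: (@rebase _ A _ _ (p1, p2, 0, 0) (q1, q2, 0, 0) m 0 1 _ m0 _ _ pA) => //=.
  exact: oner_neq0.
move=> [[[x1 x2] x3] x4] [[[y1 y2] y3] y4]; rewrite /mul2gen /change BB'.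
by congr (_, _, _, _); rewrite /ev /=; ring.
Qed.

(** In the tables of the algebras whose form B has rank one, e2 is the square of
    e1 and e3 is the second generator. *)
Definition swap23 (x : vec4 K) : vec4 K :=
  let: (x1, x2, x3, x4) := x in (x1, x3, x2, x4).

Lemma presented_swap A M : presented A M ->
  presented A (fun x y => swap23 (M (swap23 x) (swap23 y))).
Proof.
case=> v1 [v2 [v3 [v4 [bv Mv]]]]; exists v1, v3, v2, v4; split.
  rewrite -(perm_basis (X := [:: v1; v2; v3; v4])) //.
  by rewrite perm_cons (perm_catCA [:: v2] [:: v3] [:: v4]).
have swapE x : comb v1 v3 v2 v4 x = comb v1 v2 v3 v4 (swap23 x).
  by case: x => [[[x1 x2] x3] x4]; rewrite /comb /=; congr (_ + _); rewrite addrAC.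
have swapK x : swap23 (swap23 x) = x by case: x => [[[x1 x2] x3] x4].
by move=> x y; rewrite !swapE Mv swapK.
Qed.

Lemma mul2gen_scale A B C a b (x y m k : K) B' C' a' b' :
  presented A (mul2gen B C a b) -> x != 0 -> y != 0 -> m != 0 -> k != 0 ->
  (forall x1 x2 y1 y2, ev B (x1 * x) (x2 * y) (y1 * x) (y2 * y) =
     m * ev B' x1 x2 y1 y2) ->
  (forall x1 x2 y1 y2, ev C (x1 * x) (x2 * y) (y1 * x) (y2 * y) =
     k * ev C' x1 x2 y1 y2) ->
  m * a.1 * x = k * a'.1 -> m * a.2 * y = k * a'.2 ->
  m * b.1 * x = k * b'.1 -> m * b.2 * y = k * b'.2 ->
  presented A (mul2gen B' C' a' b').
Proof.
move=> pA x0 y0 m0 k0 BB CC a1 a2 b1 b2.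
apply: (@rebase _ A _ _ (x, 0, 0, 0) (0, y, 0, 0) m 0 k _ m0 k0 _ pA) => /=.
  by rewrite mulr0 subr0 mulf_neq0.
move=> [[[x1 x2] x3] x4] [[[y1 y2] y3] y4]; rewrite /mul2gen /change.
rewrite !mulr0 !addr0 !add0r BB CC; congr (_, _, _, _); try ring.
apply: (eq_of_sub (u := x1 * y3 * (m * a.1 * x) + x2 * y3 * (m * a.2 * y) +
  y1 * x3 * (m * b.1 * x) + y2 * x3 * (m * b.2 * y))
  (v := x1 * y3 * (k * a'.1) + x2 * y3 * (k * a'.2) +
  y1 * x3 * (k * b'.1) + y2 * x3 * (k * b'.2))).
  by rewrite a1 a2 b1 b2.
ring.
Qed.

(** Left symmetry gives a(e2) = 0, and b(e2) = 0 is the Novikov case. Otherwise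
    e1 is corrected by a multiple of e2 to get b(e1) = 0, and t1, t2, n cancel
    all of C but C(e2, e1). This scalar and a(e1) remain, and the two generators
    can be rescaled independently. *)
Lemma classify_square A C a b :
  presented A (mul2gen (Form 1 0 0 0) C a b) -> left_symmetric A ->
  novikov A \/ classified A.
Proof.
move=> pA lsA; have [/= + _] := mul2gen_left_symmetric pA lsA.
rewrite subr0 mul0r mulr0 mulr1 sub0r => /esym/eqP; rewrite oppr_eq0 => /eqP a2.
have [b20|b20] := eqVneq b.2 0.
  by left; apply: mul2gen_novikov pA lsA _ _ => /=; rewrite ?b20 !(mul0r, mulr0).
right; case: C a b a2 b20 pA => C11 C12 C21 C22 [a1 _] [b1 b2] /= -> b20 pA.
have {C11 C12 C21 C22 a1 b1 b2 b20 pA} [c [a pA]] : exists c a : K,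
    presented A (mul2gen (Form 1 0 0 0) (Form 0 0 c 0) (a, 0) (0, 1)).
  pose d := b1 / b2; pose t2 := - C22 / b2.
  pose t1 := - (C12 - d * C22 + a1 * t2) / b2.
  pose n := C11 - d * (C12 + C21) + d ^+ 2 * C22 + a1 * t1.
  exists ((C21 - d * C22) / b2), (a1 / b2).
  apply: (@rebase _ A _ _ (1, - d, t1, 0) (0, 1, t2, 0) 1 n b2 _ _ b20 _ pA);
    rewrite /= ?mulr0 ?subr0 ?mulr1 ?oner_neq0 //.
  move=> [[[x1 x2] x3] x4] [[[y1 y2] y3] y4]; rewrite /mul2gen /change /ev /=.
  by congr (_, _, _, _); rewrite /n /t1 /t2 /d; field.
have {pA} [c' [a' pA]] : exists c' a' : bool,
    presented A (mul2gen (Form 1 0 0 0) (Form 0 0 c'%:R 0) (a'%:R, 0) (0, 1)).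
  exists (c != 0), (a != 0).
  pose x : K := if c == 0 then 1 else c.
  pose y : K := if a == 0 then 1 else x * a.
  have x0 : x != 0 by rewrite /x; case: ifPn => // _; exact: oner_neq0.
  have y0 : y != 0.
    by rewrite /y; case: ifPn => // a0; rewrite ?oner_neq0 ?mulf_neq0.
  have cE : c = x * (c != 0)%:R.
    by rewrite /x; case: eqP => [->|_]; rewrite ?mulr0 ?mulr1.
  have aE : x * a = y * (a != 0)%:R.
    by rewrite /y; case: eqP => [->|_]; rewrite ?mulr0 ?mulr1.
  apply: (@mul2gen_scale A _ _ _ _ x y (x ^+ 2) (x ^+ 2 * y) _ _ _ _ pA) => //=;
    rewrite ?mulf_neq0 ?expf_neq0 ?mulr0 ?mul0r //.
  - by move=> *; rewrite /ev /=; ring.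
  - by move=> *; rewrite /ev /= {1}cE; ring.
  - by rewrite -!mulrA -aE; ring.
  - ring.
have := presented_swap pA; case: c' a' {pA} => [] [] /= pA;
  [ apply: presented_classified pA (L4_01 _) _
  | apply: presented_classified pA (L4_02 _) _
  | apply: presented_classified pA (L4_03 _) _
  | apply: presented_classified pA (L4_04 _) _ ];
  rewrite /swap23 /mul2gen /ev /=; check_table.
Qed.

(** Left symmetry gives a = 0, and b is moved by the orthogonal similitudes: its
    orbit depends on whether b1 ^+ 2 + b2 ^+ 2 vanishes. An isotropic b is a
    multiple of (1, i) or (1, -i), exchanged by a reflection. *)
Lemma classify_sum A C a b :
  presented A (mul2gen (Form 1 0 0 1) C a b) -> left_symmetric A ->
  novikov A \/ classified A.
Proof.
move=> pA lsA; have [/= ls1 ls2] := mul2gen_left_symmetric pA lsA.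
have a1 : a.1 = 0 by apply: (eq_of_sub (esym ls2)); ring.
have a2 : a.2 = 0 by apply: (eq_of_sub ls1); ring.
case: C a b a1 a2 {ls1 ls2} pA => C11 C12 C21 C22 [_ _] [b1 b2] /= -> -> pA.
have [N0|N0] := eqVneq (b1 ^+ 2 + b2 ^+ 2) 0; last first.
  right; have {pA} [c pA] : exists c,
      presented A (mul2gen (Form 1 0 0 1) (Form 0 c 0 0) (0, 0) (1, 0)).
    pose C := Form C11 C12 C21 C22; pose N := b1 ^+ 2 + b2 ^+ 2.
    pose n := ev C (- b2) b1 (- b2) b1.
    pose t1 := (n - ev C b1 b2 b1 b2) / N.
    pose t2 := - ev C (- b2) b1 b1 b2 / N.
    exists (ev C b1 b2 (- b2) b1 / N ^+ 2).
    apply: (@rebase _ A _ _ (b1, b2, t1, 0) (- b2, b1, t2, 0) N n (N ^+ 2)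
              _ _ _ _ pA) => //=.
    - by have -> : b1 * b1 - b2 * - b2 = N by rewrite /N; ring.
    - by rewrite expf_neq0.
    move=> [[[x1 x2] x3] x4] [[[y1 y2] y3] y4]; rewrite /mul2gen /change /t1 /t2 /n.
    by rewrite /ev /N /=; congr (_, _, _, _); field.
  have [c0|c0] := eqVneq c 0.
    subst c; apply: presented_classified pA (L4_05 _) _; rewrite /mul2gen /ev /=.
    check_table.
  have {}pA : presented A (mul2gen (Form 1 0 0 1) (Form 0 1 0 0) (0, 0) (1, 0)).
    apply: (@mul2gen_scale A _ _ _ _ c c (c ^+ 2) (c ^+ 3) _ _ _ _ pA) => //=;
      rewrite ?expf_neq0 // => *; rewrite /ev /=; ring.
  apply: presented_classified pA (L4_06 _) _; rewrite /mul2gen /ev /=.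
  check_table.
have [b10|b10] := eqVneq b1 0.
  left; apply: mul2gen_novikov pA lsA _ _ => /=; last by rewrite b10; ring.
  move: N0; rewrite b10 expr0n add0r => /eqP; rewrite expf_eq0 => /= /eqP ->.
  ring.
right; have i2 : ('i%C : K) ^+ 2 = - 1 := sqr_i R.
have {pA} [c pA] : exists c,
    presented A (mul2gen (Form 1 0 0 1) (Form 0 c 0 0) (0, 0) (1, 'i%C)).
  (* h = 1 or h = -1, the sign of the reflection of the second generator. *)
  pose h := - 'i%C * (b2 / b1).
  have h2 : h ^+ 2 = 1.
    have -> : h ^+ 2 = 'i%C ^+ 2 * (b2 ^+ 2 / b1 ^+ 2) by rewrite /h; field.
    have -> : b2 ^+ 2 = - b1 ^+ 2 by apply: (eq_of_sub N0); ring.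
    by rewrite i2; field.
  have b2E : b2 = 'i%C * h * b1.
    have -> : 'i%C * h * b1 = - ('i%C ^+ 2) * b2 by rewrite /h; field.
    by rewrite i2; ring.
  clearbody h; subst b2.
  pose t2 := - C21 * h / b1.
  pose n := C22 - 'i%C * h * C21.
  pose t1 := (n - C11) / b1.
  exists ((C12 * h + 'i%C * t1 * b1) / b1).
  apply: (@rebase _ A _ _ (1, 0, t1, 0) (0, h, t2, 0) 1 n b1 _ _ b10 _ pA);
    rewrite /= ?mulr0 ?subr0 ?mul1r ?oner_neq0 //.
    by apply: contra_eq_neq h2 => ->; rewrite expr0n eq_sym oner_neq0.
  move=> [[[x1 x2] x3] x4] [[[y1 y2] y3] y4]; rewrite /mul2gen /change /t1 /t2 /n.
  by rewrite /ev /=; congr (_, _, _, _); field: h2 i2.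
have [c0|c0] := eqVneq c 0.
  subst c; apply: presented_classified pA (L4_07 _) _; rewrite /mul2gen /ev /=.
  check_table.
have {}pA : presented A (mul2gen (Form 1 0 0 1) (Form 0 1 0 0) (0, 0) (1, 'i%C)).
  apply: (@mul2gen_scale A _ _ _ _ c c (c ^+ 2) (c ^+ 3) _ _ _ _ pA) => //=;
    rewrite ?expf_neq0 // => *; rewrite /ev /=; ring.
apply: presented_classified pA (L4_08 _) _; rewrite /mul2gen /ev /=.
check_table.
Qed.

(** Left symmetry gives a = - 2 b, and every linear automorphism of the plane is
    a similitude of an alternating form. The second generator is taken in the
    kernel of b. *)
Lemma classify_skew A C a b :
  presented A (mul2gen (Form 0 1 (- 1) 0) C a b) -> left_symmetric A ->
  novikov A \/ classified A.
Proof.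
move=> pA lsA; have [/= ls1 ls2] := mul2gen_left_symmetric pA lsA.
have a1 : a.1 = - 2 * b.1 by apply: (eq_of_sub ls1); ring.
have a2 : a.2 = - 2 * b.2 by apply: (eq_of_sub ls2); ring.
case: C a b a1 a2 {ls1 ls2} pA => C11 C12 C21 C22 [_ _] [b1 b2] /= -> -> pA.
have [[p1 [p2]]|[b10 b20]] :
    (exists p1 p2 : K, b1 * p1 + b2 * p2 != 0) \/ b1 = 0 /\ b2 = 0.
- have [b10|b10] := eqVneq b1 0; last first.
    by left; exists 1, 0; rewrite mulr1 mulr0 addr0.
  have [b20|b20] := eqVneq b2 0; first by right.
  by left; exists 0, 1; rewrite mulr1 mulr0 add0r.
- set m := _ + _ => m0; right.
  have {pA} [c pA] : exists c,
      presented A (mul2gen (Form 0 1 (- 1) 0) (Form 0 0 0 c) (- 2, 0) (1, 0)).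
    pose C := Form C11 C12 C21 C22.
    pose t1 := ev C p1 p2 p1 p2 / m.
    pose t2 := (ev C p1 p2 (- b2) b1 + ev C (- b2) b1 p1 p2) / m.
    pose n := - ev C p1 p2 (- b2) b1 - 2 * ev C (- b2) b1 p1 p2.
    exists (ev C (- b2) b1 (- b2) b1 / m ^+ 2).
    apply: (@rebase _ A _ _ (p1, p2, t1, 0) (- b2, b1, t2, 0) m n (m ^+ 2)
              _ m0 _ _ pA) => //=.
    - by have -> : p1 * b1 - p2 * - b2 = m by rewrite /m; ring.
    - by rewrite expf_neq0.
    move=> [[[x1 x2] x3] x4] [[[y1 y2] y3] y4]; rewrite /mul2gen /change /t1 /t2 /n.
    by rewrite /ev /m /=; congr (_, _, _, _); field.
  have [c0|c0] := eqVneq c 0.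
    subst c; apply: presented_classified pA (L4_09 _) _; rewrite /mul2gen /ev /=.
    check_table.
  have {}pA : presented A
      (mul2gen (Form 0 1 (- 1) 0) (Form 0 0 0 1) (- 2, 0) (1, 0)).
    apply: (@mul2gen_scale A _ _ _ _ 1 (1 / c) (1 / c) (1 / c) _ _ _ _ pA) => //=;
      rewrite ?oner_neq0 ?div1r ?invr_eq0 // => *;
      by rewrite /ev /=; field.
  apply: presented_classified pA (L4_10 _) _; rewrite /mul2gen /ev /=.
  check_table.
by left; apply: mul2gen_novikov pA lsA _ _ => /=; rewrite b10 b20; ring.
Qed.

(** The two roots s of s ^+ 2 = 1 - 4 * l give the two linear factors of
    a1 ^+ 2 - a1 * a2 + l * a2 ^+ 2. If one of them vanishes at a then a is a
    multiple of (2 l, 1 - s), and rescaling e4 removes the factor. The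
    coefficients t1, t2, n solve the linear system that cancels all of C but
    C(e2, e2); its determinant is proportional to l ^+ 3 * (1 + s), nonzero as
    (1 - s) (1 + s) = 4 l. *)
Lemma reduce_isotropic A C a l s :
  presented A (mul2gen (Form l 0 1 1) C a (l * a.2 - a.1, - a.1)) ->
  l != 0 -> s ^+ 2 = 1 - 4 * l -> 2 * a.1 = (1 + s) * a.2 -> a.2 != 0 ->
  exists c : bool,
    presented A (mul2gen (Form l 0 1 1) (Form 0 0 0 c%:R)
      (2 * l, 1 - s) (- l * (1 + s), - 2 * l)).
Proof.
case: C a => C11 C12 C21 C22 [a1 a2] /= pA l0 s2 a1E a20.
have ss : (1 - s) * (1 + s) = 4 * l.
  by have -> : (1 - s) * (1 + s) = 1 - s ^+ 2 by [ring]; rewrite s2; ring.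
have /andP[sm0 sp0] : (1 - s != 0) && (1 + s != 0).
  by rewrite -negb_or -mulf_eq0 ss mulf_neq0 ?pnatr_eq0.
pose k : K := a2 / (1 - s).
have k0 : k != 0 by rewrite mulf_neq0 ?invr_eq0.
have a2k : a2 = k * (1 - s) by rewrite divfK.
have a1k : a1 = k * (2 * l).
  apply: (mulfI (x := 2)); first by rewrite pnatr_eq0.
  rewrite a1E a2k; have -> : (1 + s) * (k * (1 - s)) = k * ((1 - s) * (1 + s)).
    ring.
  by rewrite ss; ring.
clearbody k; subst a1 a2.
have {C11 C12 C21 C22 k k0 a1E a20 pA} [c pA] : exists c,
    presented A (mul2gen (Form l 0 1 1) (Form 0 0 0 c)
      (2 * l, 1 - s) (- l * (1 + s), - 2 * l)).
  pose t1 := k^-1 * (C21 + (1 + s) * C12 / 2 - C11 / l) / (l * (1 + s)).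
  pose t2 := t1 - k^-1 * C12 / (2 * l).
  pose n := C11 / l + k * (1 - s) * t1.
  exists (k^-1 * (C22 - n + k * (1 - s - 2 * l) * t2)).
  apply: (@rebase _ A _ _ (1, 0, t1, 0) (0, 1, t2, 0) 1 n k _ _ k0 _ pA);
    rewrite /= ?mulr0 ?subr0 ?mul1r ?oner_neq0 //.
  move=> [[[x1 x2] x3] x4] [[[y1 y2] y3] y4]; rewrite /mul2gen /change /n /t2 /t1.
  by rewrite /ev /=; congr (_, _, _, _); field; rewrite ?sp0 ?k0 ?l0 ?pnatr_eq0.
exists (c != 0); have [c0|c0] := eqVneq c 0; first by rewrite c0 in pA.
apply: (@mul2gen_scale A _ _ _ _ c c (c ^+ 2) (c ^+ 3) _ _ _ _ pA) => //=;
  rewrite ?expf_neq0 // => *; by rewrite /ev /=; ring.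
Qed.

(** Left symmetry gives b in terms of a. If l = 0 then b is a multiple of (1, 1),
    as are the rows of B, and the algebra is Novikov. Otherwise let Q be the
    value at a of the quadratic form adjugate to the symmetric part of B, which
    similitudes of B preserve up to a factor. The covectors with Q nonzero form a
    single orbit up to scaling; those with Q = 0 form the isotropic lines. *)
Lemma classify_generic A C a b l (sqrt_spec : forall l,
    sqrt (1 - 4 * l) ^+ 2 = 1 - 4 * l) :
  presented A (mul2gen (Form l 0 1 1) C a b) -> left_symmetric A ->
  novikov A \/ classified A.
Proof.
move=> pA lsA; have [/= ls1 ls2] := mul2gen_left_symmetric pA lsA.
have b1 : b.1 = l * a.2 - a.1 by apply: (eq_of_sub (esym ls1)); ring.
have b2 : b.2 = - a.1 by apply: (eq_of_sub (esym ls2)); ring.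
have [l0|l0] := eqVneq l 0.
  by left; apply: mul2gen_novikov pA lsA _ _ => /=; rewrite b1 b2 l0; ring.
case: C a b b1 b2 {ls1 ls2} pA => C11 C12 C21 C22 [a1 a2] [_ _] /= -> -> pA.
pose Q := a1 ^+ 2 - a1 * a2 + l * a2 ^+ 2.
have [Q0|Q0] := eqVneq Q 0; last first.
  right; have {pA} [c pA] : exists c,
      presented A (mul2gen (Form l 0 1 1) (Form 0 c 0 0) (0, 1) (l, 0)).
    pose C := Form C11 C12 C21 C22.
    (* q = (q1, q2) determines p = (q1 + q2, - l q1) by B(p, q) = 0 and
       B(q, p) = B(q, q); q is chosen to have a(p) = 0, so B(q, q) = l Q. *)
    pose p1 := l * a2; pose p2 := - l * a1; pose q1 := a1; pose q2 := l * a2 - a1.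
    pose n := (ev C p1 p2 p1 p2 / l + l * ev C q1 q2 q1 q2 - ev C q1 q2 p1 p2) / l.
    pose t1 := (n * l - ev C p1 p2 p1 p2) / (l * Q).
    pose t2 := (n - ev C q1 q2 q1 q2) / Q.
    exists (ev C p1 p2 q1 q2 / (l * Q ^+ 2)).
    apply: (@rebase _ A _ _ (p1, p2, t1, 0) (q1, q2, t2, 0) (l * Q) n (l * Q ^+ 2)
              _ _ _ _ pA) => /=; rewrite ?mulf_neq0 ?expf_neq0 //.
      have -> : p1 * q2 - p2 * q1 = l * Q by rewrite /p1 /p2 /q1 /q2 /Q; ring.
      by rewrite mulf_neq0.
    move=> [[[x1 x2] x3] x4] [[[y1 y2] y3] y4]; rewrite /mul2gen /change /t1 /t2 /n.
    rewrite /ev /C /p1 /p2 /q1 /q2 /Q /=; congr (_, _, _, _); field;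
      by rewrite ?l0 ?andbT.
  have [c0|c0] := eqVneq c 0.
    subst c; apply: presented_classified pA (L4_11 _ l0) _; rewrite /mul2gen /ev /=.
    check_table.
  have {}pA : presented A (mul2gen (Form l 0 1 1) (Form 0 1 0 0) (0, 1) (l, 0)).
    apply: (@mul2gen_scale A _ _ _ _ c c (c ^+ 2) (c ^+ 3) _ _ _ _ pA) => //=;
      rewrite ?expf_neq0 // => *; by rewrite /ev /=; ring.
  apply: presented_classified pA (L4_12 _ l0) _; rewrite /mul2gen /ev /=.
  check_table.
have [a20|a20] := eqVneq a2 0.
  have a10 : a1 = 0.
    move: Q0; rewrite /Q a20 mulr0 expr0n mulr0 subr0 addr0 => /eqP.
    by rewrite expf_eq0 => /eqP.
  by left; apply: mul2gen_novikov pA lsA _ _ => /=; rewrite a10 a20; ring.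
pose s := sqrt (1 - 4 * l); have s2 : s ^+ 2 = 1 - 4 * l := sqrt_spec l.
right; have : (2 * a1 - (1 + s) * a2) * (2 * a1 - (1 - s) * a2) = 0.
  have -> : (2 * a1 - (1 + s) * a2) * (2 * a1 - (1 - s) * a2) =
    4 * a1 ^+ 2 - 4 * a1 * a2 + (1 - s ^+ 2) * a2 ^+ 2 by ring.
  by rewrite s2 -[RHS](mulr0 4) -Q0 /Q; ring.
move/eqP; rewrite mulf_eq0 !subr_eq0 => /orP[] /eqP a1E.
  have [[] {}pA] := reduce_isotropic pA l0 s2 a1E a20.
    apply: presented_classified pA (L4_14 _ l0) _; rewrite -/s /mul2gen /ev /=.
    check_table.
  apply: presented_classified pA (L4_13 _ l0) _; rewrite -/s /mul2gen /ev /=.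
  check_table.
have s2' : (- s) ^+ 2 = 1 - 4 * l by rewrite sqrrN.
have [[] {}pA] := reduce_isotropic pA l0 s2' a1E a20.
  apply: presented_classified pA (L4_16 _ l0) _; rewrite -/s /mul2gen /ev /=.
  check_table.
apply: presented_classified pA (L4_15 _ l0) _; rewrite -/s /mul2gen /ev /=.
check_table.
Qed.

Lemma classify_two_generators A B C a b (sqrt_spec : forall l,
    sqrt (1 - 4 * l) ^+ 2 = 1 - 4 * l) :
  presented A (mul2gen B C a b) -> left_symmetric A -> novikov A \/ classified A.
Proof.
move=> pA lsA; have [B0|[B' nB BB']] := congruent_normal B.
  by left; apply: mul2gen_novikov pA lsA _ _; rewrite B0 /= !mul0r.
have [C' [a' [b' {}pA]]] := congruent_presented pA BB'.
case: nB pA => [|||l] pA.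
- exact: classify_square pA lsA.
- exact: classify_sum pA lsA.
- exact: classify_skew pA lsA.
- exact: classify_generic sqrt_spec pA lsA.
Qed.

End TwoGenerators.

(** * The classification *)

Theorem theoremA (R : realType) (sqrt : R[i] -> R[i])
    (sqrt_spec : forall lambda : R[i],
       sqrt (1 - 4 * lambda) ^+ 2 = 1 - 4 * lambda)
    (L : algebra R[i]) :
  \dim {:L} = 4%N -> left_symmetric L -> nilpotent L ->
  novikov L \/
  exists2 t : table R[i], listed sqrt t & isomorphic L (table_algebra t).
Proof.
move=> d4 lsL nL.
have [d1|d1] := leqP (\dim (series L 1)) 1.
  by left; apply: small_square_novikov.
have d3 : (\dim (series L 1) < 4)%N.
  by rewrite -d4 (@descend_dim _ L fullv) ?subvf ?d4.
have [d2|d2] := eqVneq (\dim (series L 1)) 2%N.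
  have [B [C [a [b pL]]]] := presented_two_generators lsL nL d4 d2.
  exact: classify_two_generators sqrt_spec pL lsL.
have {d1 d2} d1 : \dim (series L 1) = 3%N.
  by case: (\dim _) d1 d2 d3 => [|[|[|[|]]]].
have [a [b [p [q [r [s [t [u [pL ab0]]]]]]]]] :=
  presented_one_generator lsL nL d4 d1.
exact: classify_one_generator pL lsL ab0.
Qed.
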